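(* Let $(T,m,e)$ be a 2-monad on a 2-category $\mathcal{K}$. If $\mathcal{K}$ admits, and $T$ preserves, $(l,c)$-codescent objects, then the 2-functor $\mathcal{I}\colon T\text{-}\mathrm{LDAdj}\to \mathrm{Lax}\text{-}T\text{-}\mathrm{Alg}_c$ has a fully faithful left 2-adjoint $\mathscr{Q}\colon \mathrm{Lax}\text{-}T\text{-}\mathrm{Alg}_c\to T\text{-}\mathrm{LDAdj}$, which maps a lax algebra $\mathbb{X}$ (with underlying object $X$) to the lax doctrinal adjunction $p\dashv q$, $p\colon X\rightleftarrows \mathcal{Q}\mathbb{X}\colon q$, between $\mathbb{X}$ and its colax morphism classifier $\mathcal{Q}\mathbb{X}$.
   Context: **2-monads and algebras.** All 2-categories, 2-functors, 2-natural transformations and 2-monads are strict ($\mathbf{Cat}$-enriched). $m\colon T^2\Rightarrow T$ and $e\colon 1\Rightarrow T$ are the multiplication and unit. Composition of 1-cells and whiskering are written $g.f$ or $gf$; vertical composition of 2-cells is written $\circ$; $mT$, $Tm$, $eT$, $Te$ denote $m_{TX}$, $T(m_X)$, $e_{TX}$, $T(e_X)$. A *lax algebra* $\mathbb{X}=(X,x,\xi^2,\xi^0)$ consists of an object $X$ of $\mathcal K$, a 1-cell $x\colon TX\to X$ and 2-cells $\xi^2\colon x.Tx\Rightarrow x.m$, $\xi^0\colon 1_X\Rightarrow x.e$ with $(\xi^2.Tm)\circ(x.T\xi^2)=(\xi^2.mT)\circ(\xi^2.T^2x)$, $(\xi^2.Te)\circ(x.T\xi^0)=1_x$, $(\xi^2.eT)\circ(\xi^0.x)=1_x$.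 It is a *strict algebra* if $\xi^2,\xi^0$ are identities. A *colax morphism* $(f,\bar f)\colon(X,x,\xi^2,\xi^0)\rightsquigarrow(Y,y,\upsilon^2,\upsilon^0)$ is a 1-cell $f\colon X\to Y$ with a 2-cell $\bar f\colon f.x\Rightarrow y.Tf$ such that $(\bar f.m)\circ(f.\xi^2)=(\upsilon^2.T^2f)\circ(y.T\bar f)\circ(\bar f.Tx)$ and $(\bar f.e)\circ(f.\xi^0)=\upsilon^0.f$. It is a strict morphism if $\bar f$ is an identity. A 2-cell $(f,\bar f)\Rightarrow(g,\bar g)$ is a 2-cell $\alpha\colon f\Rightarrow g$ with $\bar g\circ(\alpha.x)=(y.T\alpha)\circ\bar f$. These form the 2-category $\mathrm{Lax}\text{-}T\text{-}\mathrm{Alg}_c$; strict algebras, strict morphisms and 2-cells form $T\text{-}\mathrm{Alg}_s$, with forgetful 2-functor $U\colon T\text{-}\mathrm{Alg}_s\to\mathcal K$. **Codescent objects.** *Lax coherence data* in a 2-category consist of objects $X_0,X_1,X_2$, 1-cells $r,s,t\colon X_2\to X_1$, $v,w\colon X_1\to X_0$, $i\colon X_0\to X_1$ with $vi=1$, $vs=vr$, $wr=vt$, and 2-cells $\chi^2\colon wt\Rightarrow ws$, $\chi^0\colon 1\Rightarrow wi$. An *$(l,c)$-codescent object* (colax codescent object of lax coherence data) is a triple $(C,c\colon X_0\to C,\gamma\colon cw\Rightarrow cv)$ with $(\gamma s)\circ(c\chi^2)=(\gamma r)\circ(\gamma t)$ and $(\gamma i)\circ(c\chi^0)=1_c$,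 universal (one- and two-dimensionally, as a weighted colimit) among such triples. **Colax morphism classifier.** Under the hypotheses, $T\text{-}\mathrm{Alg}_s$ has $(l,c)$-codescent objects, and the inclusion $T\text{-}\mathrm{Alg}_s\to\mathrm{Lax}\text{-}T\text{-}\mathrm{Alg}_c$ has a left 2-adjoint $\mathcal Q$, the colax morphism classifier. $\mathcal Q\mathbb X$ is the $(l,c)$-codescent object $(\mathcal{Q}\mathbb X,\ g\colon T\mathbb X\to\mathcal Q\mathbb X,\ \bar g\colon g.Tx\Rightarrow g.m)$ of the lax coherence data in $T\text{-}\mathrm{Alg}_s$ on free algebras $X_0=TX$, $X_1=T^2X$, $X_2=T^3X$ with $r=mT$, $s=Tm$, $t=T^2x$, $v=m$, $w=Tx$, $i=Te$, $\chi^2=T\xi^2$, $\chi^0=T\xi^0$; its underlying object in $\mathcal K$ is the $(l,c)$-codescent object of the underlying data. The unit $\mathbb X\rightsquigarrow\mathcal Q\mathbb X$ has underlying 1-cell $p=g.e\colon X\to U\mathcal Q\mathbb X$. The 1-cell $q\colon U\mathcal Q\mathbb X\to X$ is the one determined by $q.\bar g=\xi^2$ (in particular $q.g=x$); it is right adjoint to $p$ in $\mathcal K$, with unit $\xi^0$. **Lax doctrinal adjunctions.** A *lax doctrinal adjunction* $l\colon X\rightleftarrows\mathbb A\colon r$ is a strict algebra $\mathbb A=(A,a)$ together with an adjunction $l\dashv r$ in $\mathcal K$, $l\colon X\to A$, with unit $\eta$ and counit $\varepsilon$. $T\text{-}\mathrm{LDAdj}$ is the full sub-2-category of the comma 2-category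 $\mathrm{Id}_{\mathcal K}/U$ on these (via $l$): a 1-cell from $l\colon X\rightleftarrows\mathbb A$ to $l'\colon Y\rightleftarrows\mathbb B$ is a pair $(f\colon X\to Y,\ \mathbb f\colon\mathbb A\to\mathbb B)$ with $\mathbb f$ a strict morphism and $l'f=\mathbb f l$; a 2-cell is a pair $(\alpha\colon f\Rightarrow g,\ \beta\colon\mathbb f\Rightarrow\mathbb g)$ with $l'\alpha=\beta l$. The 2-functor $\mathcal I$ sends $l\colon X\rightleftarrows\mathbb A\colon r$ to the lax algebra on $X$ with $x=r.a.Tl$, $\xi^2\colon x.Tx=r.a.Tl.Tr.Ta.T^2l\Rightarrow r.a.Ta.T^2l=r.a.m.T^2l=x.m$ given by $T\varepsilon$, and $\xi^0=\eta\colon 1\Rightarrow rl=r.a.e.l=x.e$. It sends $(f,\mathbb f)$ to the colax morphism $(f,\bar f)$, where, with $\mathbb B=(B,b)$, $\eta'$ the unit of $l'\dashv r'$ and $y=r'.b.Tl'$, $\bar f$ is the composite $f.r.a.Tl\overset{\eta'}{\Rightarrow}r'.l'.f.r.a.Tl=r'.\mathbb f.l.r.a.Tl\overset{\varepsilon}{\Rightarrow}r'.\mathbb f.a.Tl=r'.b.Tl'.Tf$. It sends $(\alpha,\beta)$ to $\alpha$. *)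

(* Defs.v *)
From Stdlib Require Import ssreflect ProofIrrelevance ClassicalEpsilon.

Set Implicit Arguments.
Unset Strict Implicit.
Unset Printing Implicit Defensive.

(* A 2-cell packed with its boundary.  1-cell composition is associative only up
   to propositional equality, so an equation between 2-cells whose boundaries
   are equal but not convertible is stated between packed cells. *)
Inductive cell {A : Type} (R : A -> A -> Type) : Type :=
  Cell : forall f g : A, R f g -> cell R.
Arguments Cell {A R f g} _.

Definition cdom {A} {R : A -> A -> Type} (c : cell R) : A :=
  match c with @Cell _ _ f _ _ => f end.
Definition ccod {A} {R : A -> A -> Type} (c : cell R) : A :=
  match c with @Cell _ _ _ g _ => g end.

(* Cat-enriched categories: [hom2 a b] is the hom-category and
   [(comp1, hcomp)] the composition functor. *)
Record TwoCat : Type := mkTwoCat {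
  ob :> Type;
  hom : ob -> ob -> Type;
  hom2 : forall a b, hom a b -> hom a b -> Type;
  id1 : forall a, hom a a;
  comp1 : forall a b c, hom b c -> hom a b -> hom a c;
  id2 : forall a b (f : hom a b), hom2 f f;
  vcomp : forall a b (f g h : hom a b), hom2 g h -> hom2 f g -> hom2 f h;
  hcomp : forall a b c (g g' : hom b c) (f f' : hom a b),
    hom2 g g' -> hom2 f f' -> hom2 (comp1 g f) (comp1 g' f');
  vcomp_id_l : forall a b (f g : hom a b) (α : hom2 f g),
    vcomp (id2 g) α = α;
  vcomp_id_r : forall a b (f g : hom a b) (α : hom2 f g),
    vcomp α (id2 f) = α;
  vcomp_assoc : forall a b (f g h k : hom a b)
      (γ : hom2 h k) (β : hom2 g h) (α : hom2 f g),
    vcomp γ (vcomp β α) = vcomp (vcomp γ β) α;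
  hcomp_id : forall a b c (g : hom b c) (f : hom a b),
    hcomp (id2 g) (id2 f) = id2 (comp1 g f);
  interchange : forall a b c (g g' g'' : hom b c) (f f' f'' : hom a b)
      (β' : hom2 g' g'') (β : hom2 g g') (α' : hom2 f' f'') (α : hom2 f f'),
    hcomp (vcomp β' β) (vcomp α' α) = vcomp (hcomp β' α') (hcomp β α);
  comp1_id_l : forall a b (f : hom a b), comp1 (id1 b) f = f;
  comp1_id_r : forall a b (f : hom a b), comp1 f (id1 a) = f;
  comp1_assoc : forall a b c d (h : hom c d) (g : hom b c) (f : hom a b),
    comp1 h (comp1 g f) = comp1 (comp1 h g) f;
  hcomp_id_l : forall a b (f g : hom a b) (α : hom2 f g),
    Cell (hcomp (id2 (id1 b)) α) = Cell α;
  hcomp_id_r : forall a b (f g : hom a b) (α : hom2 f g),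
    Cell (hcomp α (id2 (id1 a))) = Cell α;
  hcomp_assoc : forall a b c d (h h' : hom c d) (g g' : hom b c) (f f' : hom a b)
      (γ : hom2 h h') (β : hom2 g g') (α : hom2 f f'),
    Cell (hcomp γ (hcomp β α)) = Cell (hcomp (hcomp γ β) α)
}.

Arguments hom : clear implicits.
Arguments hom2 {t a b} f g.
Arguments id1 {t} a.
Arguments comp1 {t a b c} g f.
Arguments id2 {t a b} f.
Arguments vcomp {t a b f g h} β α.
Arguments hcomp {t a b c g g' f f'} β α.

Notation "g · f" := (comp1 g f) (at level 39, right associativity).

Section Cells.
Variable C : TwoCat.

Definition lwhisk {a b c : C} (h : hom C b c) {f g : hom C a b}
  (α : hom2 f g) : hom2 (h · f) (h · g) := hcomp (id2 h) α.
Definition rwhisk {a b c : C} {f g : hom C b c} (α : hom2 f g)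
  (h : hom C a b) : hom2 (f · h) (g · h) := hcomp α (id2 h).

Definition heq {a b : C} {f g f' g' : hom C a b}
  (α : hom2 f g) (β : hom2 f' g') : Prop := Cell α = Cell β.

Definition recast {a b : C} {f g f' g' : hom C a b} (α : hom2 f g)
  (E1 : f = f') (E2 : g = g') : hom2 f' g' :=
  match E1 in _ = x, E2 in _ = y return hom2 x y with
  | eq_refl, eq_refl => α
  end.
Definition paste {a b : C} {f g g' h : hom C a b} (β : hom2 g' h)
  (α : hom2 f g) (E : g = g') : hom2 f h :=
  vcomp β (recast α eq_refl E).
Definition eqcell {a b : C} {f g : hom C a b} (E : f = g) : hom2 f g :=
  recast (id2 f) eq_refl E.

End Cells.

(* In [β • α] and [⟨ α ⟩] the equality of boundaries is found by instance search, so
   that pastings are written without naming the associativity, functoriality and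
   naturality proofs involved. *)
Class Same {A : Type} (x y : A) : Prop := same : x = y.

Notation "h ◃ α" := (lwhisk h α) (at level 42, right associativity).
Notation "α ▹ h" := (rwhisk α h) (at level 41, left associativity).
Notation "β • α" := (paste β α same) (at level 45, right associativity).
Notation "⟨ α ⟩" := (recast α same same) (at level 0, α at level 200).
Notation "α ≈ β" := (heq α β) (at level 70, no associativity).

Section Calculus.
Variable C : TwoCat.

Definition cells (a b : C) := cell (@hom2 C a b).

Definition wl {a b c : C} (h : hom C b c) (x : cells a b) : cells a c :=
  match x with Cell α => Cell (h ◃ α) end.
Definition wr {a b c : C} (x : cells b c) (h : hom C a b) : cells a c :=
  match x with Cell α => Cell (α ▹ h) end.
Definition ic {a b : C} (f : hom C a b) : cells a b := Cell (id2 f).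
(* Total; [y] when the boundaries do not match. *)
Definition vc {a b : C} (x y : cells a b) : cells a b :=
  match y, x with
  | @Cell _ _ f g α, @Cell _ _ g' h β =>
    match excluded_middle_informative (g = g') with
    | left E => Cell (paste β α E)
    | right _ => Cell α
    end
  end.
Arguments vc : simpl never.

Lemma Cell_inj (a b : C) (f g : hom C a b) (α β : hom2 f g) :
  Cell α = Cell β -> α = β.
Proof.
move=> E.
pose un (c : cells a b) : {p : hom C a b * hom C a b & hom2 (fst p) (snd p)} :=
  match c with @Cell _ _ f g α => existT (fun p => hom2 (fst p) (snd p)) (f, g) α end.
have := f_equal un E => /= {}E.
exact: (EqdepTheory.inj_pair2 _ (fun p => hom2 (fst p) (snd p)) (f, g) _ _ E).
Qed.

Lemma cell_recast (a b : C) (f g f' g' : hom C a b) (α : hom2 f g)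
  (E1 : f = f') (E2 : g = g') : Cell (recast α E1 E2) = Cell α.
Proof. by destruct E1, E2. Qed.

Lemma cell_eqcell (a b : C) (f g : hom C a b) (E : f = g) :
  Cell (eqcell E) = ic f.
Proof. by destruct E. Qed.

Lemma cell_paste (a b : C) (f g g' h : hom C a b) (β : hom2 g' h)
  (α : hom2 f g) (E : g = g') : Cell (paste β α E) = vc (Cell β) (Cell α).
Proof.
rewrite /vc; case: excluded_middle_informative => [E'|] //.
by rewrite (proof_irrelevance _ E E').
Qed.

Lemma cell_vcomp (a b : C) (f g h : hom C a b) (β : hom2 g h) (α : hom2 f g) :
  Cell (vcomp β α) = vc (Cell β) (Cell α).
Proof. by rewrite -(cell_paste β α eq_refl). Qed.

Lemma cell_wl (a b c : C) (h : hom C b c) (f g : hom C a b) (α : hom2 f g) :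
  Cell (h ◃ α) = wl h (Cell α).
Proof. by []. Qed.

Lemma cell_wr (a b c : C) (f g : hom C b c) (α : hom2 f g) (h : hom C a b) :
  Cell (α ▹ h) = wr (Cell α) h.
Proof. by []. Qed.

Lemma vcE (a b : C) (f g h : hom C a b) (β : hom2 g h) (α : hom2 f g) :
  vc (Cell β) (Cell α) = Cell (vcomp β α).
Proof. by rewrite cell_vcomp. Qed.

Lemma cdom_wl (a b c : C) (h : hom C b c) (x : cells a b) :
  cdom (wl h x) = h · cdom x.
Proof. by case: x. Qed.
Lemma ccod_wl (a b c : C) (h : hom C b c) (x : cells a b) :
  ccod (wl h x) = h · ccod x.
Proof. by case: x. Qed.
Lemma cdom_wr (a b c : C) (h : hom C a b) (x : cells b c) :
  cdom (wr x h) = cdom x · h.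
Proof. by case: x. Qed.
Lemma ccod_wr (a b c : C) (h : hom C a b) (x : cells b c) :
  ccod (wr x h) = ccod x · h.
Proof. by case: x. Qed.
Lemma cdom_vc (a b : C) (x y : cells a b) :
  ccod y = cdom x -> cdom (vc x y) = cdom y.
Proof. by case: x => g' h β; case: y => f g α /= E; subst; rewrite vcE. Qed.
Lemma ccod_vc (a b : C) (x y : cells a b) :
  ccod y = cdom x -> ccod (vc x y) = ccod x.
Proof. by case: x => g' h β; case: y => f g α /= E; subst; rewrite vcE. Qed.

Lemma vc_assoc (a b : C) (x y z : cells a b) :
  ccod z = cdom y -> ccod y = cdom x -> vc x (vc y z) = vc (vc x y) z.
Proof.
case: x => ? ? γ; case: y => ? ? β; case: z => ? ? α /= E1 E2; subst.
by rewrite !vcE vcomp_assoc.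
Qed.
Lemma vc_id_l (a b : C) (f : hom C a b) (x : cells a b) :
  ccod x = f -> vc (ic f) x = x.
Proof. by case: x => ? ? α /= E; subst; rewrite vcE vcomp_id_l. Qed.
Lemma vc_id_r (a b : C) (f : hom C a b) (x : cells a b) :
  cdom x = f -> vc x (ic f) = x.
Proof. by case: x => ? ? α /= E; subst; rewrite vcE vcomp_id_r. Qed.

Lemma wl_ic (a b c : C) (h : hom C b c) (f : hom C a b) :
  wl h (ic f) = ic (h · f).
Proof. by rewrite /= /lwhisk hcomp_id. Qed.
Lemma wr_ic (a b c : C) (h : hom C b c) (f : hom C a b) :
  wr (ic h) f = ic (h · f).
Proof. by rewrite /= /rwhisk hcomp_id. Qed.
Lemma wl_vc (a b c : C) (h : hom C b c) (x y : cells a b) :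
  ccod y = cdom x -> wl h (vc x y) = vc (wl h x) (wl h y).
Proof.
case: x => ? ? β; case: y => ? ? α /= E; subst; rewrite !vcE /= /lwhisk.
by rewrite -interchange vcomp_id_l.
Qed.
Lemma wr_vc (a b c : C) (h : hom C a b) (x y : cells b c) :
  ccod y = cdom x -> wr (vc x y) h = vc (wr x h) (wr y h).
Proof.
case: x => ? ? β; case: y => ? ? α /= E; subst; rewrite !vcE /= /rwhisk.
by rewrite -interchange vcomp_id_l.
Qed.
Lemma wl_wl (a b c d : C) (h : hom C c d) (k : hom C b c) (x : cells a b) :
  wl h (wl k x) = wl (h · k) x.
Proof. by case: x => f g α /=; rewrite /lwhisk hcomp_assoc hcomp_id. Qed.
Lemma wr_wr (a b c d : C) (x : cells c d) (h : hom C b c) (k : hom C a b) :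
  wr (wr x h) k = wr x (h · k).
Proof. by case: x => f g α /=; rewrite /rwhisk -hcomp_assoc hcomp_id. Qed.
Lemma wr_wl (a b c d : C) (h : hom C c d) (x : cells b c) (k : hom C a b) :
  wr (wl h x) k = wl h (wr x k).
Proof. by case: x => f g α /=; rewrite /rwhisk /lwhisk hcomp_assoc. Qed.
Lemma wl_id (a b : C) (x : cells a b) : wl (id1 b) x = x.
Proof. by case: x => f g α /=; rewrite /lwhisk hcomp_id_l. Qed.
Lemma wr_id (a b : C) (x : cells a b) : wr x (id1 a) = x.
Proof. by case: x => f g α /=; rewrite /rwhisk hcomp_id_r. Qed.
Lemma hcomp_wh (a b c : C) (g g' : hom C b c) (f f' : hom C a b)
  (β : hom2 g g') (α : hom2 f f') :
  hcomp β α = vcomp (β ▹ f') (g ◃ α).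
Proof. by rewrite /lwhisk /rwhisk -interchange vcomp_id_l vcomp_id_r. Qed.
Lemma vc_xch (a b c : C) (y : cells b c) (x : cells a b) :
  vc (wr y (ccod x)) (wl (cdom y) x) = vc (wl (ccod y) x) (wr y (cdom x)).
Proof.
case: x => f f' α; case: y => g g' β /=; rewrite !vcE /lwhisk /rwhisk.
by rewrite -!interchange !vcomp_id_l !vcomp_id_r.
Qed.

End Calculus.
Arguments vc {C a b} x y : simpl never.

Record TwoFunctor (C D : TwoCat) : Type := mkTwoFunctor {
  fob :> C -> D;
  fmap : forall a b : C, hom C a b -> hom D (fob a) (fob b);
  fmap2 : forall (a b : C) (f g : hom C a b), hom2 f g -> hom2 (fmap f) (fmap g);
  fmap_id : forall a : C, fmap (id1 a) = id1 (fob a);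
  fmap_comp : forall (a b c : C) (g : hom C b c) (f : hom C a b),
    fmap (g · f) = fmap g · fmap f;
  fmap2_id : forall (a b : C) (f : hom C a b), fmap2 (id2 f) = id2 (fmap f);
  fmap2_vcomp : forall (a b : C) (f g h : hom C a b) (β : hom2 g h) (α : hom2 f g),
    fmap2 (vcomp β α) = vcomp (fmap2 β) (fmap2 α);
  fmap2_hcomp : forall (a b c : C) (g g' : hom C b c) (f f' : hom C a b)
      (β : hom2 g g') (α : hom2 f f'),
    fmap2 (hcomp β α) ≈ hcomp (fmap2 β) (fmap2 α)
}.
Arguments fmap {C D} t {a b} f.
Arguments fmap2 {C D} t {a b f g} α.

Definition idF (C : TwoCat) : TwoFunctor C C.
Proof.
by apply: (@mkTwoFunctor C C (fun a => a) (fun _ _ f => f) (fun _ _ _ _ α => α)).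
Defined.

Lemma fmap2_heq (C D : TwoCat) (F : TwoFunctor C D) (a b : C)
  (f g f' g' : hom C a b) (α : hom2 f g) (β : hom2 f' g') :
  α ≈ β -> fmap2 F α ≈ fmap2 F β.
Proof.
move=> E; pose m (c : cells a b) : cells (F a) (F b) :=
  match c with Cell γ => Cell (fmap2 F γ) end.
exact: (f_equal m E).
Qed.

Definition compF (C D E : TwoCat) (G : TwoFunctor D E) (F : TwoFunctor C D) :
  TwoFunctor C E.
Proof.
apply: (@mkTwoFunctor C E (fun a => G (F a)) (fun _ _ f => fmap G (fmap F f))
  (fun _ _ _ _ α => fmap2 G (fmap2 F α))).
- by move=> a; rewrite !fmap_id.
- by move=> *; rewrite !fmap_comp.
- by move=> *; rewrite !fmap2_id.
- by move=> *; rewrite !fmap2_vcomp.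
- move=> a b c g g' f f' β α.
  exact: eq_trans (fmap2_heq G (fmap2_hcomp F β α)) (fmap2_hcomp _ _ _).
Defined.

Record TwoNat (C D : TwoCat) (F G : TwoFunctor C D) : Type := mkTwoNat {
  ncomp :> forall a : C, hom D (F a) (G a);
  nat1 : forall (a b : C) (f : hom C a b), fmap G f · ncomp a = ncomp b · fmap F f;
  nat2 : forall (a b : C) (f g : hom C a b) (α : hom2 f g),
    fmap2 G α ▹ ncomp a ≈ ncomp b ◃ fmap2 F α
}.

Record TwoAdj (C D : TwoCat) (F : TwoFunctor C D) (G : TwoFunctor D C) : Type :=
  mkTwoAdj {
  unit2 : TwoNat (idF C) (compF G F);
  counit2 : TwoNat (compF F G) (idF D);
  triangle_l : forall a : C, counit2 (F a) · fmap F (unit2 a) = id1 (F a);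
  triangle_r : forall b : D, fmap G (counit2 b) · unit2 (G b) = id1 (G b)
}.

Definition bijective {A B : Type} (f : A -> B) : Prop :=
  forall y, exists! x, f x = y.

(* The functors between hom-categories are isomorphisms. *)
Definition fully_faithful (C D : TwoCat) (F : TwoFunctor C D) : Prop :=
  (forall a b : C, bijective (fun f : hom C a b => fmap F f)) /\
  (forall (a b : C) (f g : hom C a b),
     bijective (fun α : hom2 f g => fmap2 F α)).

Section FunctorCells.
Variables (C D : TwoCat) (F : TwoFunctor C D).

Definition fc {a b : C} (x : cells a b) : cells (F a) (F b) :=
  match x with Cell α => Cell (fmap2 F α) end.

Lemma cell_fmap2 (a b : C) (f g : hom C a b) (α : hom2 f g) :
  Cell (fmap2 F α) = fc (Cell α).
Proof. by []. Qed.
Lemma cdom_fc (a b : C) (x : cells a b) : cdom (fc x) = fmap F (cdom x).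
Proof. by case: x. Qed.
Lemma ccod_fc (a b : C) (x : cells a b) : ccod (fc x) = fmap F (ccod x).
Proof. by case: x. Qed.
Lemma fc_ic (a b : C) (f : hom C a b) : fc (ic f) = ic (fmap F f).
Proof. by rewrite /= fmap2_id. Qed.
Lemma fc_vc (a b : C) (x y : cells a b) :
  ccod y = cdom x -> fc (vc x y) = vc (fc x) (fc y).
Proof.
by case: x => ? ? β; case: y => ? ? α /= E; subst; rewrite !vcE /= fmap2_vcomp.
Qed.
Lemma fc_wl (a b c : C) (h : hom C b c) (x : cells a b) :
  fc (wl h x) = wl (fmap F h) (fc x).
Proof. by case: x => f g α; rewrite /= [LHS]fmap2_hcomp fmap2_id. Qed.
Lemma fc_wr (a b c : C) (x : cells b c) (h : hom C a b) :
  fc (wr x h) = wr (fc x) (fmap F h).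
Proof. by case: x => f g α; rewrite /= [LHS]fmap2_hcomp fmap2_id. Qed.

End FunctorCells.

(* Equality of composite 1-cells, and of boundaries of pasted 2-cells. *)
Ltac bd :=
  unfold Same; simpl;
  repeat first
    [ rewrite cdom_vc; [ solve [bd] | ] | rewrite ccod_vc; [ solve [bd] | ]
    | rewrite cdom_wl | rewrite ccod_wl | rewrite cdom_wr | rewrite ccod_wr
    | rewrite cdom_fc | rewrite ccod_fc ];
  simpl;
  repeat match goal with
  | H : cdom _ = _ |- _ => progress rewrite ?H
  | H : ccod _ = _ |- _ => progress rewrite ?H
  end;
  autorewrite with bd;
  reflexivity.

#[export] Hint Extern 0 (Same _ _) => bd : typeclass_instances.

Lemma comp1_assoc_r (C : TwoCat) (a b c d : C) (h : hom C c d) (g : hom C b c)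
  (f : hom C a b) : (h · g) · f = h · g · f.
Proof. by rewrite comp1_assoc. Qed.

Create HintDb bd.
#[export] Hint Rewrite comp1_assoc_r comp1_id_l comp1_id_r fmap_comp fmap_id : bd.

Record LaxCohData (C : TwoCat) : Type := mkLaxCohData {
  cd_X0 : C; cd_X1 : C; cd_X2 : C;
  cd_r : hom C cd_X2 cd_X1; cd_s : hom C cd_X2 cd_X1; cd_t : hom C cd_X2 cd_X1;
  cd_v : hom C cd_X1 cd_X0; cd_w : hom C cd_X1 cd_X0;
  cd_i : hom C cd_X0 cd_X1;
  cd_vi : cd_v · cd_i = id1 cd_X0;
  cd_vs : cd_v · cd_s = cd_v · cd_r;
  cd_wr : cd_w · cd_r = cd_v · cd_t;
  cd_chi2 : hom2 (cd_w · cd_t) (cd_w · cd_s);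
  cd_chi0 : hom2 (id1 cd_X0) (cd_w · cd_i)
}.

#[export] Hint Rewrite cd_vi cd_vs cd_wr : bd.

Record Cocone (C : TwoCat) (D : LaxCohData C) (A : C) : Type := mkCocone {
  cc : hom C (cd_X0 D) A;
  cg : hom2 (cc · cd_w D) (cc · cd_v D);
  cocone_mul :
    (cg ▹ cd_s D) • (cc ◃ cd_chi2 D) ≈ (cg ▹ cd_r D) • (cg ▹ cd_t D);
  cocone_unit :
    (cg ▹ cd_i D) • (cc ◃ cd_chi0 D) ≈ id2 cc
}.

(* (l,c)-codescent objects: the isomorphism between the hom-category out of the
   apex and the category of triples, on objects and on morphisms. *)
Record is_codescent (C : TwoCat) (D : LaxCohData C) (A : C) (κ : Cocone D A) : Prop := {
  codescent_1 : forall (B : C) (κ' : Cocone D B),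
    exists! h : hom C A B, h · cc κ = cc κ' /\ h ◃ cg κ ≈ cg κ';
  codescent_2 : forall (B : C) (h k : hom C A B)
      (θ : hom2 (h · cc κ) (k · cc κ)),
    (k ◃ cg κ) • (θ ▹ cd_w D) ≈ (θ ▹ cd_v D) • (h ◃ cg κ) ->
    exists! φ : hom2 h k, φ ▹ cc κ = θ
}.

Definition has_codescent (C : TwoCat) : Prop :=
  forall D : LaxCohData C, exists (A : C) (κ : Cocone D A), is_codescent κ.

Section MapCodescent.
Variables (C E : TwoCat) (F : TwoFunctor C E).

Definition map_data (D : LaxCohData C) : LaxCohData E.
Proof.
refine (@mkLaxCohData E (F (cd_X0 D)) (F (cd_X1 D)) (F (cd_X2 D))
  (fmap F (cd_r D)) (fmap F (cd_s D)) (fmap F (cd_t D)) (fmap F (cd_v D)) (fmap F (cd_w D))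
  (fmap F (cd_i D)) _ _ _ ⟨fmap2 F (cd_chi2 D)⟩ ⟨fmap2 F (cd_chi0 D)⟩).
- by rewrite -fmap_comp cd_vi fmap_id.
- by rewrite -!fmap_comp cd_vs.
- by rewrite -!fmap_comp cd_wr.
Defined.

Definition map_cocone (D : LaxCohData C) (A : C) (κ : Cocone D A) :
  Cocone (map_data D) (F A).
Proof.
refine (@mkCocone E (map_data D) (F A) (fmap F (cc κ)) ⟨fmap2 F (cg κ)⟩ _ _).
- have := f_equal (fc F) (cocone_mul κ).
  rewrite /heq !cell_paste.
  rewrite !fc_vc; try bd.
  by rewrite !cell_wl !cell_wr !cell_recast !fc_wl !fc_wr.
- have := f_equal (fc F) (cocone_unit κ).
  rewrite /heq !cell_paste.
  rewrite fc_vc; try bd.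
  by rewrite !cell_wl !cell_wr !cell_recast !fc_wl !fc_wr !cell_fmap2 -/(ic _) fc_ic.
Defined.

Definition preserves_codescent : Prop :=
  forall (D : LaxCohData C) (A : C) (κ : Cocone D A),
    is_codescent κ -> is_codescent (map_cocone κ).

End MapCodescent.

Record TwoMonad (K : TwoCat) : Type := mkTwoMonad {
  endo :> TwoFunctor K K;
  mult : TwoNat (compF endo endo) endo;
  munit : TwoNat (idF K) endo;
  monad_assoc : forall X : K,
    mult X · fmap endo (mult X) = mult X · (mult (endo X));
  monad_unit_T : forall X : K, mult X · fmap endo (munit X) = id1 (endo X);
  monad_unit_l : forall X : K, mult X · (munit (endo X)) = id1 (endo X)
}.

Section MonadLemmas.
Variables (K : TwoCat) (T : TwoMonad K).

Definition m (X : K) : hom K (T (T X)) (T X) := mult T X.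
Definition e (X : K) : hom K X (T X) := munit T X.

Lemma mm (X : K) : m X · fmap T (m X) = m X · m (T X).
Proof. exact: monad_assoc. Qed.
Lemma mTe (X : K) : m X · fmap T (e X) = id1 (T X).
Proof. exact: monad_unit_T. Qed.
Lemma meT (X : K) : m X · e (T X) = id1 (T X).
Proof. exact: monad_unit_l. Qed.
Lemma m_nat (X Y : K) (f : hom K X Y) : m Y · fmap T (fmap T f) = fmap T f · m X.
Proof. by have := nat1 (mult T) f. Qed.
Lemma e_nat (X Y : K) (f : hom K X Y) : fmap T f · e X = e Y · f.
Proof. exact: (nat1 (munit T) f). Qed.
Lemma mm_r (X Y : K) (k : hom K Y _) : m X · fmap T (m X) · k = m X · m (T X) · k.
Proof. by rewrite !comp1_assoc mm. Qed.
Lemma mTe_r (X Y : K) (k : hom K Y _) : m X · fmap T (e X) · k = k.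
Proof. by rewrite comp1_assoc mTe comp1_id_l. Qed.
Lemma meT_r (X Y : K) (k : hom K Y _) : m X · e (T X) · k = k.
Proof. by rewrite comp1_assoc meT comp1_id_l. Qed.
Lemma m_nat_r (X Y Z : K) (f : hom K X Y) (k : hom K Z _) :
  m Y · fmap T (fmap T f) · k = fmap T f · m X · k.
Proof. by rewrite !comp1_assoc m_nat. Qed.
Lemma e_nat_r (X Y Z : K) (f : hom K X Y) (k : hom K Z _) :
  fmap T f · e X · k = e Y · f · k.
Proof. by rewrite !comp1_assoc e_nat. Qed.

Lemma Tm_nat (X Y : K) (f : hom K X Y) :
  fmap T (m Y) · fmap T (fmap T (fmap T f)) = fmap T (fmap T f) · fmap T (m X).
Proof. by rewrite -!fmap_comp m_nat. Qed.
Lemma Te_nat (X Y : K) (f : hom K X Y) :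
  fmap T (fmap T f) · fmap T (e X) = fmap T (e Y) · fmap T f.
Proof. by rewrite -!fmap_comp e_nat. Qed.
Lemma Tm_nat_r (X Y Z : K) (f : hom K X Y) (k : hom K Z _) :
  fmap T (m Y) · fmap T (fmap T (fmap T f)) · k = fmap T (fmap T f) · fmap T (m X) · k.
Proof. by rewrite !comp1_assoc Tm_nat. Qed.
Lemma Te_nat_r (X Y Z : K) (f : hom K X Y) (k : hom K Z _) :
  fmap T (fmap T f) · fmap T (e X) · k = fmap T (e Y) · fmap T f · k.
Proof. by rewrite !comp1_assoc Te_nat. Qed.

Lemma wl_m (X Y : K) (x : cells X Y) : wl (m Y) (fc T (fc T x)) = wr (fc T x) (m X).
Proof. by case: x => f g α; exact: eq_sym (nat2 (mult T) α). Qed.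
Lemma wl_e (X Y : K) (x : cells X Y) : wr (fc T x) (e X) = wl (e Y) x.
Proof. by case: x => f g α; exact: (nat2 (munit T) α). Qed.

End MonadLemmas.

#[export] Hint Rewrite Tm_nat Tm_nat_r Te_nat Te_nat_r mm mTe meT m_nat e_nat mm_r mTe_r meT_r m_nat_r e_nat_r : bd.

(* Replaces the packed cell [c] by a variable [x] with known boundary. *)
Ltac absc c x :=
  let d := eval simpl in (cdom c) in
  let k := eval simpl in (ccod c) in
  let Hd := fresh "d" x in let Hk := fresh "c" x in
  have Hd : cdom c = d by []; have Hk : ccod c = k by [];
  set (x := c) in *; clearbody x.

(* Opens pasting equations into equations between packed cells. *)
Ltac opn :=
  rewrite /heq ?(cell_paste, cell_vcomp, cell_wl, cell_wr, cell_fmap2, cell_recast,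
    cell_eqcell).

(* Pushes whiskerings and functors to the leaves, associates to the right. *)
Ltac push :=
  repeat first
    [ rewrite wl_vc; [ solve [bd] | ] | rewrite wr_vc; [ solve [bd] | ]
    | rewrite fc_vc; [ solve [bd] | ]
    | rewrite wr_wl | rewrite wl_wl | rewrite wr_wr | rewrite fc_wl | rewrite fc_wr
    | rewrite wl_ic | rewrite wr_ic | rewrite fc_ic | rewrite wl_id | rewrite wr_id
    | rewrite vc_id_l; [ solve [bd] | ] | rewrite vc_id_r; [ solve [bd] | ]
    | rewrite -vc_assoc; [ solve [bd] | solve [bd] | ] ];
  autorewrite with bd;
  rewrite ?wl_id ?wr_id.

(* Rewrites with [E : vc x y = _] where [x], [y] start a longer composite. *)
Lemma vc_pre (C : TwoCat) (a b : C) (x y z w : cells a b) :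
  vc x y = w -> ccod y = cdom x -> ccod z = cdom y -> vc x (vc y z) = vc w z.
Proof. by move=> <- E1 E2; rewrite vc_assoc. Qed.
Ltac pre E := rewrite (vc_pre E); [ solve [bd] | solve [bd] | ].

Section LaxAlgebras.
Variables (K : TwoCat) (T : TwoMonad K).

Record LaxAlg : Type := mkLaxAlg {
  lob :> K;
  lx : hom K (T lob) lob;
  lxi2 : hom2 (lx · fmap T lx) (lx · m T lob);
  lxi0 : hom2 (id1 lob) (lx · e T lob);
  lax_assoc :
    (lxi2 ▹ fmap T (m T lob)) • (lx ◃ fmap2 T lxi2) ≈
    (lxi2 ▹ m T (T lob)) • (lxi2 ▹ fmap T (fmap T lx));
  lax_unit_T : (lxi2 ▹ fmap T (e T lob)) • (lx ◃ fmap2 T lxi0) ≈ id2 lx;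
  lax_unit_l : (lxi2 ▹ e T (T lob)) • (lxi0 ▹ lx) ≈ id2 lx
}.

Record ColaxMor (X Y : LaxAlg) : Type := mkColaxMor {
  cf :> hom K X Y;
  cbar : hom2 (cf · lx X) (lx Y · fmap T cf);
  colax_mul :
    (cbar ▹ m T X) • (cf ◃ lxi2 X) ≈
    (lxi2 Y ▹ fmap T (fmap T cf)) • (lx Y ◃ fmap2 T cbar) • (cbar ▹ fmap T (lx X));
  colax_unit : (cbar ▹ e T X) • (cf ◃ lxi0 X) ≈ lxi0 Y ▹ cf
}.

Record ColaxCell (X Y : LaxAlg) (f g : ColaxMor X Y) : Type := mkColaxCell {
  ca :> hom2 (cf f) (cf g);
  colax_cell :
    vcomp (cbar g) (ca ▹ lx X) = vcomp (lx Y ◃ fmap2 T ca) (cbar f)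
}.

Lemma ColaxMor_eq (X Y : LaxAlg) (f g : ColaxMor X Y) :
  cf f = cf g -> cbar f ≈ cbar g -> f = g.
Proof.
case: f => f fb f1 f2; case: g => g gb g1 g2 /= E; subst g => /Cell_inj E.
subst gb; by rewrite (proof_irrelevance _ f1 g1) (proof_irrelevance _ f2 g2).
Qed.

Lemma ColaxCell_eq (X Y : LaxAlg) (f g : ColaxMor X Y) (α β : ColaxCell f g) :
  ca α = ca β -> α = β.
Proof.
case: α => α p; case: β => β q /= E; subst; by rewrite (proof_irrelevance _ p q).
Qed.

Lemma ColaxCell_heq (X Y : LaxAlg) (f g f' g' : ColaxMor X Y)
  (α : ColaxCell f g) (β : ColaxCell f' g') :
  f = f' -> g = g' -> ca α ≈ ca β -> Cell α = Cell β.
Proof.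
move=> E1 E2; subst => /Cell_inj E; congr Cell; exact: ColaxCell_eq.
Qed.

Definition colax_id (X : LaxAlg) : ColaxMor X X.
Proof.
refine (@mkColaxMor X X (id1 X) ⟨id2 (lx X)⟩ _ _).
- abstract (opn; rewrite -!/(ic _); absc (Cell (lxi2 X)) ξ; by push).
- abstract (opn; rewrite -!/(ic _); absc (Cell (lxi0 X)) ξ; by push).
Defined.

Definition colax_comp (X Y Z : LaxAlg) (g : ColaxMor Y Z) (f : ColaxMor X Y) :
  ColaxMor X Z.
Proof.
refine (@mkColaxMor X Z (cf g · cf f) ⟨(cbar g ▹ fmap T (cf f)) • (cf g ◃ cbar f)⟩ _ _).
- abstract (
    move: (colax_mul f) (colax_mul g); opn => Hf Hg;
    absc (Cell (cbar f)) F; absc (Cell (cbar g)) G;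
    absc (Cell (lxi2 X)) ξ; absc (Cell (lxi2 Y)) υ; absc (Cell (lxi2 Z)) ζ;
    have := f_equal (wl g) Hf;
    have := f_equal (fun c => wr c (fmap T (fmap T f))) Hg;
    have := vc_xch G (fc T F); rewrite cdom_fc ccod_fc dF cF dG cG;
    push => E1 E2 E3;
    by rewrite E3; pre E2; push; pre E1; push).
- abstract (
    move: (colax_unit f) (colax_unit g); opn => Hf Hg;
    absc (Cell (cbar f)) F; absc (Cell (cbar g)) G;
    absc (Cell (lxi0 X)) ξ; absc (Cell (lxi0 Y)) υ; absc (Cell (lxi0 Z)) ζ;
    have := f_equal (wl g) Hf; have := f_equal (fun c => wr c f) Hg;
    push => E1 E2;
    by rewrite E2).
Defined.

Definition colax_cell_id (X Y : LaxAlg) (f : ColaxMor X Y) : ColaxCell f f.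
Proof.
refine (@mkColaxCell X Y f f (id2 (cf f)) _).
abstract (apply: Cell_inj; opn; rewrite -!/(ic _); absc (Cell (cbar f)) F; by push).
Defined.

Definition colax_cell_vcomp (X Y : LaxAlg) (f g h : ColaxMor X Y)
  (β : ColaxCell g h) (α : ColaxCell f g) : ColaxCell f h.
Proof.
refine (@mkColaxCell X Y f h (vcomp β α) _).
abstract (
  move: (f_equal Cell (colax_cell α)) (f_equal Cell (colax_cell β));
  rewrite fmap2_vcomp => Hα Hβ;
  apply: Cell_inj; move: Hα Hβ; opn => Hα Hβ;
  absc (Cell (cbar f)) F; absc (Cell (cbar g)) G; absc (Cell (cbar h)) H;
  absc (Cell (ca α)) a; absc (Cell (ca β)) b;
  push; pre Hβ; push; by rewrite Hα).
Defined.

Definition colax_cell_hcomp (X Y Z : LaxAlg) (g g' : ColaxMor Y Z)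
  (f f' : ColaxMor X Y) (β : ColaxCell g g') (α : ColaxCell f f') :
  ColaxCell (colax_comp g f) (colax_comp g' f').
Proof.
refine (@mkColaxCell X Z (colax_comp g f) (colax_comp g' f') (hcomp β α) _).
abstract (
  move: (f_equal Cell (colax_cell α)) (f_equal Cell (colax_cell β));
  rewrite (hcomp_wh β α) => Hα Hβ;
  apply: Cell_inj; move: Hα Hβ; opn => Hα Hβ;
  absc (Cell (cbar f)) F; absc (Cell (cbar g)) G;
  absc (Cell (cbar f')) F'; absc (Cell (cbar g')) G';
  absc (Cell (ca α)) u; absc (Cell (ca β)) v;
  have := vc_xch v F'; have := vc_xch G (fc T u);
  have := f_equal (wl g) Hα; have := f_equal (fun c => wr c (fmap T f')) Hβ;
  rewrite cdom_fc ccod_fc dF' cF' dG cG dv cv du cu;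
  push => E1 E2 E3 E4;
  pre (eq_sym E4); push; pre E1; push; rewrite E2; pre E3; by push).
Defined.

Lemma colax_id_l (X Y : LaxAlg) (f : ColaxMor X Y) : colax_comp (colax_id Y) f = f.
Proof.
apply: ColaxMor_eq => /=; first exact: comp1_id_l.
opn; rewrite -!/(ic _); absc (Cell (cbar f)) F; by push.
Qed.
Lemma colax_id_r (X Y : LaxAlg) (f : ColaxMor X Y) : colax_comp f (colax_id X) = f.
Proof.
apply: ColaxMor_eq => /=; first exact: comp1_id_r.
opn; rewrite -!/(ic _); absc (Cell (cbar f)) F; by push.
Qed.
Lemma colax_comp_assoc (X Y Z W : LaxAlg) (h : ColaxMor Z W) (g : ColaxMor Y Z)
  (f : ColaxMor X Y) : colax_comp h (colax_comp g f) = colax_comp (colax_comp h g) f.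
Proof.
apply: ColaxMor_eq => /=; first exact: comp1_assoc.
opn; absc (Cell (cbar f)) F; absc (Cell (cbar g)) G; absc (Cell (cbar h)) H.
by push.
Qed.

Definition LaxTAlgc : TwoCat.
Proof.
refine (@mkTwoCat LaxAlg ColaxMor ColaxCell colax_id colax_comp colax_cell_id
  colax_cell_vcomp colax_cell_hcomp _ _ _ _ _ colax_id_l colax_id_r
  colax_comp_assoc _ _ _).
- abstract (move=> *; apply: ColaxCell_eq; exact: vcomp_id_l).
- abstract (move=> *; apply: ColaxCell_eq; exact: vcomp_id_r).
- abstract (move=> *; apply: ColaxCell_eq; exact: vcomp_assoc).
- abstract (move=> *; apply: ColaxCell_eq; exact: hcomp_id).
- abstract (move=> *; apply: ColaxCell_eq; exact: interchange).
- abstract (move=> *; apply: ColaxCell_heq; rewrite ?colax_id_l //; exact: hcomp_id_l).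
- abstract (move=> *; apply: ColaxCell_heq; rewrite ?colax_id_r //; exact: hcomp_id_r).
- abstract (move=> *; apply: ColaxCell_heq; rewrite ?colax_comp_assoc //;
    exact: hcomp_assoc).
Defined.

End LaxAlgebras.

Section StrictAlgebras.
Variables (K : TwoCat) (T : TwoMonad K).

(* A lax algebra with identity 2-cells amounts to two equations of 1-cells, and
   likewise for morphisms; [lax_of_strict] and [incl_mor] restore the 2-cells. *)
Record StrictAlg : Type := mkStrictAlg {
  sob :> K;
  sa : hom K (T sob) sob;
  s_mul : sa · fmap T sa = sa · m T sob;
  s_unit : sa · e T sob = id1 sob
}.

Record StrictMor (A B : StrictAlg) : Type := mkStrictMor {
  sf :> hom K A B;
  s_mor : sf · sa A = sa B · fmap T sf
}.

Record StrictCell (A B : StrictAlg) (f g : StrictMor A B) : Type := mkStrictCell {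
  sc :> hom2 (sf f) (sf g);
  s_cell : sc ▹ sa A ≈ sa B ◃ fmap2 T sc
}.

Lemma s_mul_r (A : StrictAlg) (X : K) (k : hom K X _) :
  sa A · fmap T (sa A) · k = sa A · m T A · k.
Proof. by rewrite !comp1_assoc s_mul. Qed.
Lemma s_unit_r (A : StrictAlg) (X : K) (k : hom K X _) : sa A · e T A · k = k.
Proof. by rewrite !comp1_assoc s_unit comp1_id_l. Qed.
Lemma s_mor_r (A B : StrictAlg) (f : StrictMor A B) (X : K) (k : hom K X _) :
  sf f · sa A · k = sa B · fmap T (sf f) · k.
Proof. by rewrite !comp1_assoc s_mor. Qed.
Lemma Ts_mor (A B : StrictAlg) (f : StrictMor A B) :
  fmap T (sf f) · fmap T (sa A) = fmap T (sa B) · fmap T (fmap T (sf f)).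
Proof. by rewrite -!fmap_comp s_mor. Qed.
Lemma Ts_mor_r (A B : StrictAlg) (f : StrictMor A B) (X : K) (k : hom K X _) :
  fmap T (sf f) · fmap T (sa A) · k = fmap T (sa B) · fmap T (fmap T (sf f)) · k.
Proof. by rewrite !comp1_assoc Ts_mor. Qed.

Lemma Ts_mul (A : StrictAlg) :
  fmap T (sa A) · fmap T (fmap T (sa A)) = fmap T (sa A) · fmap T (m T A).
Proof. by rewrite -!fmap_comp s_mul. Qed.
Lemma Ts_unit (A : StrictAlg) : fmap T (sa A) · fmap T (e T A) = id1 (T A).
Proof. by rewrite -!fmap_comp s_unit fmap_id. Qed.
Lemma Ts_mul_r (A : StrictAlg) (X : K) (k : hom K X _) :
  fmap T (sa A) · fmap T (fmap T (sa A)) · k = fmap T (sa A) · fmap T (m T A) · k.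
Proof. by rewrite !comp1_assoc Ts_mul. Qed.
Lemma Ts_unit_r (A : StrictAlg) (X : K) (k : hom K X _) :
  fmap T (sa A) · fmap T (e T A) · k = k.
Proof. by rewrite !comp1_assoc Ts_unit comp1_id_l. Qed.

End StrictAlgebras.
#[export] Hint Rewrite s_mul s_unit s_mor s_mul_r s_unit_r s_mor_r
  Ts_mul Ts_unit Ts_mor Ts_mul_r Ts_unit_r Ts_mor_r : bd.

Section StrictCategory.
Variables (K : TwoCat) (T : TwoMonad K).
Notation LaxAlg := (LaxAlg T).
Notation StrictAlg := (StrictAlg T).

Lemma StrictMor_eq (A B : StrictAlg) (f g : StrictMor A B) : sf f = sf g -> f = g.
Proof.
by case: f => f p; case: g => g q /= E; subst; rewrite (proof_irrelevance _ p q).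
Qed.
Lemma StrictCell_eq (A B : StrictAlg) (f g : StrictMor A B) (α β : StrictCell f g) :
  sc α = sc β -> α = β.
Proof.
by case: α => α p; case: β => β q /= E; subst; rewrite (proof_irrelevance _ p q).
Qed.
Lemma StrictCell_heq (A B : StrictAlg) (f g f' g' : StrictMor A B)
  (α : StrictCell f g) (β : StrictCell f' g') :
  f = f' -> g = g' -> sc α ≈ sc β -> Cell α = Cell β.
Proof.
move=> E1 E2; subst => /Cell_inj E; congr Cell; exact: StrictCell_eq.
Qed.

Definition strict_id (A : StrictAlg) : StrictMor A A.
Proof. by refine (@mkStrictMor K T A A (id1 A) _); abstract bd. Defined.
Definition strict_comp (A B D : StrictAlg) (g : StrictMor B D) (f : StrictMor A B) :
  StrictMor A D.
Proof.
refine (@mkStrictMor K T A D (sf g · sf f) _).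
abstract (bd).
Defined.
Definition strict_cell_id (A B : StrictAlg) (f : StrictMor A B) : StrictCell f f.
Proof.
refine (@mkStrictCell K T A B f f (id2 (sf f)) _).
abstract (opn; rewrite -!/(ic _); by push).
Defined.
Definition strict_cell_vcomp (A B : StrictAlg) (f g h : StrictMor A B)
  (β : StrictCell g h) (α : StrictCell f g) : StrictCell f h.
Proof.
refine (@mkStrictCell K T A B f h (vcomp β α) _).
abstract (
  move: (s_cell α) (s_cell β); opn => Hα Hβ;
  by rewrite wr_vc // Hα Hβ fc_vc // wl_vc // cdom_fc ccod_fc).
Defined.
Definition strict_cell_hcomp (A B D : StrictAlg) (g g' : StrictMor B D)
  (f f' : StrictMor A B) (β : StrictCell g g') (α : StrictCell f f') :
  StrictCell (strict_comp g f) (strict_comp g' f').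
Proof.
refine (@mkStrictCell K T A D (strict_comp g f) (strict_comp g' f') (hcomp β α) _).
abstract (
  move: (s_cell α) (s_cell β); rewrite (hcomp_wh β α); opn => Hα Hβ;
  absc (Cell (sc α)) u; absc (Cell (sc β)) v;
  have := f_equal (wl g) Hα; have := f_equal (fun c => wr c (fmap T f')) Hβ;
  push => E1 E2;
  by rewrite E2 E1).
Defined.

Lemma strict_id_l (A B : StrictAlg) (f : StrictMor A B) :
  strict_comp (strict_id B) f = f.
Proof. apply: StrictMor_eq; exact: comp1_id_l. Qed.
Lemma strict_id_r (A B : StrictAlg) (f : StrictMor A B) :
  strict_comp f (strict_id A) = f.
Proof. apply: StrictMor_eq; exact: comp1_id_r. Qed.
Lemma strict_comp_assoc (A B D E : StrictAlg) (h : StrictMor D E) (g : StrictMor B D)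
  (f : StrictMor A B) : strict_comp h (strict_comp g f) = strict_comp (strict_comp h g) f.
Proof. apply: StrictMor_eq; exact: comp1_assoc. Qed.

Definition TAlgs : TwoCat.
Proof.
refine (@mkTwoCat StrictAlg (@StrictMor K T) (@StrictCell K T) strict_id strict_comp strict_cell_id
  strict_cell_vcomp strict_cell_hcomp _ _ _ _ _ strict_id_l strict_id_r
  strict_comp_assoc _ _ _).
- abstract (move=> *; apply: StrictCell_eq; exact: vcomp_id_l).
- abstract (move=> *; apply: StrictCell_eq; exact: vcomp_id_r).
- abstract (move=> *; apply: StrictCell_eq; exact: vcomp_assoc).
- abstract (move=> *; apply: StrictCell_eq; exact: hcomp_id).
- abstract (move=> *; apply: StrictCell_eq; exact: interchange).
- abstract (move=> *; apply: StrictCell_heq; rewrite ?strict_id_l //; exact: hcomp_id_l).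
- abstract (move=> *; apply: StrictCell_heq; rewrite ?strict_id_r //; exact: hcomp_id_r).
- abstract (move=> *; apply: StrictCell_heq; rewrite ?strict_comp_assoc //;
    exact: hcomp_assoc).
Defined.

Definition forget : TwoFunctor TAlgs K.
Proof.
by refine (@mkTwoFunctor TAlgs K (fun A => sob A) (fun _ _ f => sf f)
  (fun _ _ _ _ α => sc α) _ _ _ _ _).
Defined.

Definition lax_of_strict (A : StrictAlg) : LaxAlg.
Proof.
refine (@mkLaxAlg K T A (sa A) (eqcell (s_mul A)) (eqcell (eq_sym (s_unit A))) _ _ _);
  abstract (opn; rewrite -?/(ic _); by push).
Defined.

Definition incl_mor (A B : StrictAlg) (f : StrictMor A B) :
  ColaxMor (lax_of_strict A) (lax_of_strict B).
Proof.
refine (@mkColaxMor K T (lax_of_strict A) (lax_of_strict B) (sf f) (eqcell (s_mor f)) _ _);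
  abstract (opn; push; rewrite /=; by autorewrite with bd).
Defined.

Definition incl_cell (A B : StrictAlg) (f g : StrictMor A B) (α : StrictCell f g) :
  ColaxCell (incl_mor f) (incl_mor g).
Proof.
refine (@mkColaxCell K T _ _ (incl_mor f) (incl_mor g) (sc α) _).
abstract (apply: Cell_inj; move: (s_cell α); opn => E; push; exact: E).
Defined.

Definition incl : TwoFunctor (TAlgs) (LaxTAlgc T).
Proof.
refine (@mkTwoFunctor TAlgs (LaxTAlgc T) lax_of_strict incl_mor incl_cell _ _ _ _ _).
- abstract (move=> A; apply: ColaxMor_eq => //=; opn; by rewrite -/(ic _) comp1_id_l).
- abstract (move=> A B D g f; apply: ColaxMor_eq => //=; opn; push; by rewrite /= -fmap_comp).
- abstract (move=> *; exact: ColaxCell_eq).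
- abstract (move=> *; exact: ColaxCell_eq).
- abstract (move=> A B D g g' f f' β α; apply: ColaxCell_heq => //=;
    apply: ColaxMor_eq => //=; opn; push; by rewrite /= -fmap_comp).
Defined.

Definition free (X : K) : StrictAlg := mkStrictAlg (mm T X) (meT T X).

Definition free_mor (X Y : K) (f : hom K X Y) : StrictMor (free X) (free Y) :=
  @mkStrictMor K T (free X) (free Y) (fmap T f) (eq_sym (m_nat T f)).

Definition free_mult (X : K) : StrictMor (free (T X)) (free X) :=
  @mkStrictMor K T (free (T X)) (free X) (m T X) (eq_sym (mm T X)).

Lemma free_cell_law (X Y : K) (f g : hom K X Y) (α : hom2 f g) :
  fmap2 T α ▹ m T X ≈ m T Y ◃ fmap2 T (fmap2 T α).
Proof. opn; exact: eq_sym (wl_m T (Cell α)). Qed.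

Definition coherence_data (X : LaxAlg) : LaxCohData TAlgs.
Proof.
refine (@mkLaxCohData TAlgs (free X) (free (T X)) (free (T (T X)))
  (free_mult (T X)) (free_mor (m T X)) (free_mor (fmap T (lx X)))
  (free_mult X) (free_mor (lx X)) (free_mor (e T X)) _ _ _
  (@mkStrictCell K T _ _
     (strict_comp (free_mor (lx X)) (free_mor (fmap T (lx X))))
     (strict_comp (free_mor (lx X)) (free_mor (m T X))) ⟨fmap2 T (lxi2 X)⟩ _)
  (@mkStrictCell K T _ _ (strict_id (free X))
     (strict_comp (free_mor (lx X)) (free_mor (e T X))) ⟨fmap2 T (lxi0 X)⟩ _)).
- abstract (apply: StrictMor_eq; exact: mTe).
- abstract (apply: StrictMor_eq; exact: mm).
- abstract (apply: StrictMor_eq; exact: eq_sym (m_nat T (lx X))).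
- abstract (move: (free_cell_law (lxi2 X)); by opn).
- abstract (move: (free_cell_law (lxi0 X)); by opn).
Defined.

End StrictCategory.

Record Adjunction (C : TwoCat) (a b : C) (l : hom C a b) (r : hom C b a) : Type :=
  mkAdjunction {
  adj_unit : hom2 (id1 a) (r · l);
  adj_counit : hom2 (l · r) (id1 b);
  adj_triangle_l : (adj_counit ▹ l) • (l ◃ adj_unit) ≈ id2 l;
  adj_triangle_r : (r ◃ adj_counit) • (adj_unit ▹ r) ≈ id2 r
}.

Section LDA.
Variables (K : TwoCat) (T : TwoMonad K).

Record LDAdj : Type := mkLDAdj {
  lda_ob : K;
  lda_alg : StrictAlg T;
  lda_l : hom K lda_ob lda_alg;
  lda_r : hom K lda_alg lda_ob;
  lda_adj : Adjunction lda_l lda_r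
}.

(* As in the comma 2-category, 1-cells and 2-cells ignore the right adjoints. *)
Record LDMor (X Y : LDAdj) : Type := mkLDMor {
  ld1 : hom K (lda_ob X) (lda_ob Y);
  ld2 : hom (TAlgs T) (lda_alg X) (lda_alg Y);
  ld_comm : lda_l Y · ld1 = sf ld2 · lda_l X
}.

Record LDCell (X Y : LDAdj) (f g : LDMor X Y) : Type := mkLDCell {
  lc1 : hom2 (ld1 f) (ld1 g);
  lc2 : hom2 (ld2 f) (ld2 g);
  lc_comm : lda_l Y ◃ lc1 ≈ sc lc2 ▹ lda_l X
}.

Lemma LDMor_eq (X Y : LDAdj) (f g : LDMor X Y) : ld1 f = ld1 g -> ld2 f = ld2 g -> f = g.
Proof.
case: f => f f' p; case: g => g g' q /= E E'; subst.
by rewrite (proof_irrelevance _ p q).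
Qed.
Lemma LDCell_eq (X Y : LDAdj) (f g : LDMor X Y) (α β : LDCell f g) :
  lc1 α = lc1 β -> lc2 α = lc2 β -> α = β.
Proof.
case: α => α α' p; case: β => β β' q /= E E'; subst.
by rewrite (proof_irrelevance _ p q).
Qed.
Lemma LDCell_heq (X Y : LDAdj) (f g f' g' : LDMor X Y)
  (α : LDCell f g) (β : LDCell f' g') :
  f = f' -> g = g' -> lc1 α ≈ lc1 β -> lc2 α ≈ lc2 β -> Cell α = Cell β.
Proof.
move=> E1 E2; subst => /Cell_inj E /Cell_inj E'; congr Cell; exact: LDCell_eq.
Qed.

Definition ld_id (X : LDAdj) : LDMor X X.
Proof. refine (@mkLDMor X X (id1 _) (id1 _) _); abstract bd. Defined.
Definition ld_comp (X Y Z : LDAdj) (g : LDMor Y Z) (f : LDMor X Y) : LDMor X Z.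
Proof.
refine (@mkLDMor X Z (ld1 g · ld1 f) (ld2 g · ld2 f) _).
abstract (by rewrite /= comp1_assoc ld_comm -!comp1_assoc ld_comm).
Defined.
Definition ld_cell_id (X Y : LDAdj) (f : LDMor X Y) : LDCell f f.
Proof.
refine (@mkLDCell X Y f f (id2 _) (id2 _) _).
abstract (opn; rewrite -!/(ic _) wl_ic wr_ic; by rewrite ld_comm).
Defined.
Definition ld_cell_vcomp (X Y : LDAdj) (f g h : LDMor X Y)
  (β : LDCell g h) (α : LDCell f g) : LDCell f h.
Proof.
refine (@mkLDCell X Y f h (vcomp (lc1 β) (lc1 α)) (vcomp (lc2 β) (lc2 α)) _).
abstract (
  move: (lc_comm α) (lc_comm β); rewrite /=; opn => Hα Hβ;
  by rewrite wl_vc // Hα Hβ -wr_vc).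
Defined.
Definition ld_cell_hcomp (X Y Z : LDAdj) (g g' : LDMor Y Z) (f f' : LDMor X Y)
  (β : LDCell g g') (α : LDCell f f') : LDCell (ld_comp g f) (ld_comp g' f').
Proof.
refine (@mkLDCell X Z (ld_comp g f) (ld_comp g' f')
  (hcomp (lc1 β) (lc1 α)) (hcomp (lc2 β) (lc2 α)) _).
abstract (
  move: (lc_comm α) (lc_comm β); rewrite /= !hcomp_wh; opn => Hα Hβ;
  absc (Cell (lc1 α)) u; absc (Cell (lc1 β)) v;
  absc (Cell (sc (lc2 α))) u'; absc (Cell (sc (lc2 β))) v';
  have := f_equal (wl (sf (ld2 g))) Hα; have := f_equal (fun c => wr c (ld1 f')) Hβ;
  push => E1 E2;
  by rewrite E1 !ld_comm E2).
Defined.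

Lemma ld_id_l (X Y : LDAdj) (f : LDMor X Y) : ld_comp (ld_id Y) f = f.
Proof. apply: LDMor_eq; exact: comp1_id_l. Qed.
Lemma ld_id_r (X Y : LDAdj) (f : LDMor X Y) : ld_comp f (ld_id X) = f.
Proof. apply: LDMor_eq; exact: comp1_id_r. Qed.
Lemma ld_comp_assoc (X Y Z W : LDAdj) (h : LDMor Z W) (g : LDMor Y Z) (f : LDMor X Y) :
  ld_comp h (ld_comp g f) = ld_comp (ld_comp h g) f.
Proof. apply: LDMor_eq; exact: comp1_assoc. Qed.

Definition TLDAdj : TwoCat.
Proof.
refine (@mkTwoCat LDAdj LDMor LDCell ld_id ld_comp ld_cell_id
  ld_cell_vcomp ld_cell_hcomp _ _ _ _ _ ld_id_l ld_id_r ld_comp_assoc _ _ _).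
- abstract (move=> *; apply: LDCell_eq; exact: vcomp_id_l).
- abstract (move=> *; apply: LDCell_eq; exact: vcomp_id_r).
- abstract (move=> *; apply: LDCell_eq; exact: vcomp_assoc).
- abstract (move=> *; apply: LDCell_eq; exact: hcomp_id).
- abstract (move=> *; apply: LDCell_eq; exact: interchange).
- abstract (move=> *; apply: LDCell_heq; rewrite ?ld_id_l //; exact: hcomp_id_l).
- abstract (move=> *; apply: LDCell_heq; rewrite ?ld_id_r //; exact: hcomp_id_r).
- abstract (move=> *; apply: LDCell_heq; rewrite ?ld_comp_assoc //; exact: hcomp_assoc).
Defined.

Lemma ld_comm_r (X Y : LDAdj) (f : LDMor X Y) (Z : K) (k : hom K Z _) :
  lda_l Y · ld1 f · k = sf (ld2 f) · lda_l X · k.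
Proof. by rewrite !comp1_assoc ld_comm. Qed.
Lemma Tld_comm (X Y : LDAdj) (f : LDMor X Y) :
  fmap T (lda_l Y) · fmap T (ld1 f) = fmap T (sf (ld2 f)) · fmap T (lda_l X).
Proof. by rewrite -!fmap_comp ld_comm. Qed.
Lemma Tld_comm_r (X Y : LDAdj) (f : LDMor X Y) (Z : K) (k : hom K Z _) :
  fmap T (lda_l Y) · fmap T (ld1 f) · k = fmap T (sf (ld2 f)) · fmap T (lda_l X) · k.
Proof. by rewrite !comp1_assoc Tld_comm. Qed.
Lemma TTld_comm (X Y : LDAdj) (f : LDMor X Y) :
  fmap T (fmap T (lda_l Y)) · fmap T (fmap T (ld1 f)) =
  fmap T (fmap T (sf (ld2 f))) · fmap T (fmap T (lda_l X)).
Proof. by rewrite -!fmap_comp ld_comm. Qed.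
Lemma TTld_comm_r (X Y : LDAdj) (f : LDMor X Y) (Z : K) (k : hom K Z _) :
  fmap T (fmap T (lda_l Y)) · fmap T (fmap T (ld1 f)) · k =
  fmap T (fmap T (sf (ld2 f))) · fmap T (fmap T (lda_l X)) · k.
Proof. by rewrite !comp1_assoc TTld_comm. Qed.

End LDA.
#[export] Hint Rewrite ld_comm ld_comm_r Tld_comm Tld_comm_r TTld_comm TTld_comm_r : bd.

Section LaxAlgebraOfLDA.
Variables (K : TwoCat) (T : TwoMonad K).

Section Objects.
Variable X : LDAdj T.
Notation a := (sa (lda_alg X)).
Notation l := (lda_l X).
Notation r := (lda_r X).
Notation η := (adj_unit (lda_adj X)).
Notation ε := (adj_counit (lda_adj X)).

Notation x := (r · a · fmap T l).

Definition lda_xi2 : hom2 (x · fmap T x) (x · m T (lda_ob X)) :=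
  ⟨(r · a) ◃ fmap2 T ε ▹ (fmap T a · fmap T (fmap T l))⟩.
Definition lda_xi0 : hom2 (id1 (lda_ob X)) (x · e T (lda_ob X)) := ⟨η⟩.

Definition lax_of_lda : LaxAlg T.
Proof.
refine (@mkLaxAlg K T (lda_ob X) x lda_xi2 lda_xi0 _ _ _).
- abstract (
    rewrite /lda_xi2; opn; absc (Cell ε) E;
    have := f_equal (wl (r · a)) (vc_xch (fc T E) (wl (fmap T a)
      (wr (fc T (fc T E)) (fmap T (fmap T a) · fmap T (fmap T (fmap T l))))));
    have := f_equal (fun c => wl (r · a)
      (wr c (fmap T (fmap T a) · fmap T (fmap T (fmap T l))))) (wl_m T E);
    rewrite !cdom_wl !ccod_wl !cdom_wr !ccod_wr !cdom_fc !ccod_fc dE cE;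
    push => E1 E2;
    by rewrite E2 E1; push).
- abstract (
    rewrite /lda_xi2 /lda_xi0; move: (adj_triangle_l (lda_adj X)); opn;
    absc (Cell ε) E; absc (Cell η) H; rewrite -!/(ic _) => E1;
    have := f_equal (fun c => wl (r · a) (fc T c)) E1;
    by push).
- abstract (
    rewrite /lda_xi2 /lda_xi0; move: (adj_triangle_r (lda_adj X)); opn;
    absc (Cell ε) E; absc (Cell η) H; rewrite -!/(ic _) => E1;
    have := f_equal (fun c => wr c (a · fmap T l)) E1;
    have := f_equal (fun c => wl (r · a) (wr c (a · fmap T l))) (wl_e T E);
    push => E2 E3; by rewrite E2 E3).
Defined.

End Objects.

Section Morphisms.
Variables (X Y : LDAdj T) (φ : LDMor X Y).
Notation a := (sa (lda_alg X)).
Notation b := (sa (lda_alg Y)).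
Notation l := (lda_l X).
Notation l' := (lda_l Y).
Notation r := (lda_r X).
Notation r' := (lda_r Y).
Notation ε := (adj_counit (lda_adj X)).
Notation η' := (adj_unit (lda_adj Y)).
Notation f := (ld1 φ).
Notation ff := (sf (ld2 φ)).
Notation x := (r · a · fmap T l).
Notation y := (r' · b · fmap T l').

Definition lda_bar : hom2 (f · x) (y · fmap T f) :=
  ⟨((r' · ff) ◃ ε ▹ (a · fmap T l)) • (η' ▹ (f · x))⟩.

Definition colax_of_ld : ColaxMor (lax_of_lda X) (lax_of_lda Y).
Proof.
refine (@mkColaxMor K T (lax_of_lda X) (lax_of_lda Y) f lda_bar _ _).
- abstract (
    move: (adj_triangle_l (lda_adj Y)); rewrite /= /lda_bar /lda_xi2; opn;
    absc (Cell ε) E; absc (Cell η') H'; absc (Cell (adj_counit (lda_adj Y))) E';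
    rewrite -!/(ic _) => E1;
    have := f_equal (fun c => wl (r' · b) (wr (fc T c) (fmap T f · fmap T x))) E1;
    have := vc_xch H' (wl (f · r · a) (wr (fc T E) (fmap T a · fmap T (fmap T l))));
    have := f_equal (wl (r' · ff))
      (vc_xch E (wl a (wr (fc T E) (fmap T a · fmap T (fmap T l)))));
    have := f_equal (wl (r' · b)) (vc_xch (fc T E')
      (wl (fmap T ff) (wr (fc T E) (fmap T a · fmap T (fmap T l)))));
    rewrite !cdom_wl !ccod_wl !cdom_wr !ccod_wr !cdom_fc !ccod_fc
      dE cE dE' cE' dH' cH';
    push => E2 E3 E4 E5;
    rewrite E4; pre E3; rewrite -vc_assoc; [ bd | bd | ];
    pre E2; rewrite -vc_assoc; [ bd | bd | ];
    by pre E5; push).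
- abstract (
    move: (adj_triangle_l (lda_adj X)); rewrite /= /lda_bar /lda_xi0; opn;
    absc (Cell ε) E; absc (Cell η') H'; absc (Cell (adj_unit (lda_adj X))) H;
    rewrite -!/(ic _) => E1;
    have := vc_xch H' (wl f H); have := f_equal (wl (r' · ff)) E1;
    rewrite !cdom_wl !ccod_wl dH' cH' dH cH;
    push => E2 E3;
    by rewrite E3; pre E2; push).
Defined.

End Morphisms.

Definition colax_cell_of_ld (X Y : LDAdj T) (φ ψ : LDMor X Y) (α : LDCell φ ψ) :
  ColaxCell (colax_of_ld φ) (colax_of_ld ψ).
Proof.
refine (@mkColaxCell K T _ _ (colax_of_ld φ) (colax_of_ld ψ) (lc1 α) _).
abstract (
  apply: Cell_inj; move: (lc_comm α) (s_cell (lc2 α)); rewrite /= /lda_bar; opn;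
  absc (Cell (adj_counit (lda_adj X))) E; absc (Cell (adj_unit (lda_adj Y))) H;
  absc (Cell (lc1 α)) u; absc (Cell (sc (lc2 α))) v => E1 E2;
  pose al := sa (lda_alg X) · fmap T (lda_l X);
  have := vc_xch H (wr u (lda_r X · al));
  have := f_equal (wl (lda_r Y)) (vc_xch v (wr E al));
  have := f_equal (fun c => wl (lda_r Y) (wr c (lda_r X · al))) E1;
  have := f_equal (fun c => wl (lda_r Y · sa (lda_alg Y)) (fc T c)) E1;
  have := f_equal (fun c => wl (lda_r Y) (wr c (fmap T (lda_l X)))) E2;
  rewrite {}/al !cdom_wr !ccod_wr dE cE du cu dv cv dH cH;
  push => E3 E4 E5 E6 E7;
  by rewrite E7 E5; pre (eq_sym E6); push; rewrite E4 -E3).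
Defined.

Lemma colax_of_ld_id (X : LDAdj T) : colax_of_ld (ld_id X) = colax_id (lax_of_lda X).
Proof.
apply: ColaxMor_eq => //=; rewrite /lda_bar; opn.
move: (adj_triangle_r (lda_adj X)); opn.
absc (Cell (adj_counit (lda_adj X))) E; absc (Cell (adj_unit (lda_adj X))) H.
rewrite -!/(ic _) => E1.
have := f_equal (fun c => wr c (sa (lda_alg X) · fmap T (lda_l X))) E1.
by push.
Qed.

Lemma colax_of_ld_comp (X Y Z : LDAdj T) (ψ : LDMor Y Z) (φ : LDMor X Y) :
  colax_of_ld (ld_comp ψ φ) = colax_comp (colax_of_ld ψ) (colax_of_ld φ).
Proof.
apply: ColaxMor_eq => //=; rewrite /lda_bar /=; opn.
move: (adj_triangle_l (lda_adj Y)); opn.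
absc (Cell (adj_counit (lda_adj X))) E; absc (Cell (adj_counit (lda_adj Y))) E'.
absc (Cell (adj_unit (lda_adj Y))) H; absc (Cell (adj_unit (lda_adj Z))) H'.
rewrite -!/(ic _) => E1.
pose al := sa (lda_alg X) · fmap T (lda_l X).
have := vc_xch H' (wl (ld1 ψ · lda_r Y · sf (ld2 φ)) (wr E al)).
have := vc_xch H' (wl (ld1 ψ) (wr H (ld1 φ · lda_r X · al))).
have := f_equal (wl (lda_r Z · sf (ld2 ψ))) (vc_xch E' (wl (sf (ld2 φ)) (wr E al))).
have := f_equal (fun c => wl (lda_r Z · sf (ld2 ψ)) (wr c (ld1 φ · lda_r X · al))) E1.
rewrite {}/al !cdom_wl !ccod_wl !cdom_wr !ccod_wr dE cE dE' cE' dH cH dH' cH'.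
push => E2 E3 E4 E5.
pre E5; rewrite -vc_assoc; [ bd | bd | ]; rewrite E4.
pre E3; rewrite -vc_assoc; [ bd | bd | ].
by pre E2; push.
Qed.

Definition lda_lax : TwoFunctor (TLDAdj T) (LaxTAlgc T).
Proof.
refine (@mkTwoFunctor (TLDAdj T) (LaxTAlgc T) lax_of_lda colax_of_ld
  colax_cell_of_ld colax_of_ld_id colax_of_ld_comp _ _ _).
- abstract (move=> *; exact: ColaxCell_eq).
- abstract (move=> *; exact: ColaxCell_eq).
- abstract (move=> *; apply: ColaxCell_heq => //; exact: colax_of_ld_comp).
Defined.
End LaxAlgebraOfLDA.

(* Main.v *)
From Stdlib Require Import ssreflect ClassicalEpsilon.
Require Import Defs.

Set Implicit Arguments.
Unset Strict Implicit.
Unset Printing Implicit Defensive.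

(** Both left adjoints are built from universal arrows: a 2-functor [G] has a
    left 2-adjoint as soon as every object [c] has an arrow [u c] into some
    [G (L c)] such that whiskering with it is an isomorphism of hom-categories
    ([ladj], [ladj_adj]), and that adjoint is fully faithful when the arrows
    [u c] are invertible ([ladj_fully_faithful]).

    The codescent object [C] of a diagram of strict algebras is formed in the
    base 2-category; since [T] preserves it, [T C] and [T (T C)] are codescent
    objects of the images of the diagram.  Hence the actions of the diagram
    induce an action on [C], and its laws and the universal property among
    strict algebras can be tested after restriction along the coprojections
    ([codescent_algebra], [strict_codescent]).  Let [Q] be the codescent object
    of the coherence data of a lax algebra [X], with coprojection [g] and 2-cell
    [γ].  A strict cocone on free algebras is determined by its restriction
    along the unit of the monad, and the cocone equations become the laws of a
    colax morphism.  So [(g e, γ e)] is a universal colax morphism from [X] to a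
    strict algebra ([classifier_universal_1], [classifier_universal_2]).

    The structure of [X] is itself a cocone in the base 2-category, which yields
    [q]; the 2-cell [γ e] descends to a counit, and [p = g e] becomes a left
    adjoint of [q] ([classifier_adjunction]).  Transporting the algebra [Q], with
    action [b], along this adjunction gives back [X]: [q b Tp = q g = x], and the
    multiplication obtained from the counit is [q γ = ξ²].  So the identity of
    the underlying object is an invertible colax morphism [u] from [X] to the lax
    algebra of [p ⊣ q] ([lda_unit]).

    That [u] is universal reduces to the classifier.  For every lax doctrinal
    adjunction [l ⊣ r] the counit makes [l] a colax morphism from the induced
    lax algebra to the strict one ([lda_counit]); this is natural in the
    adjunction ([lda_counit_nat]), and composing with it loses nothing besides
    the underlying 1-cell, since the 2-cell of a colax morphism into the induced
    lax algebra is the mate of that of the composite ([counit_comp_inj]).  A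
    colax morphism [F] from [X] into the induced lax algebra therefore amounts
    to its underlying 1-cell together with the strict morphism out of [Q] that
    classifies [l F], which is exactly a morphism of lax doctrinal adjunctions
    out of [p ⊣ q] ([lda_unit_universal_1], [lda_unit_universal_2]). *)

(** * Left 2-adjoints from universal arrows *)

(** Turns an equational computation of the boundary of a packed cell into a
    2-cell with the prescribed boundary. *)
Lemma cell_retype (C : TwoCat) (a b : C) (f g : hom C a b) (x : cells a b) :
  cdom x = f -> ccod x = g -> exists α : hom2 f g, Cell α = x.
Proof. by case: x => f' g' α /= E1 E2; subst; exists α. Qed.

Section UniversalArrows.
Variables (C D : TwoCat) (G : TwoFunctor D C).
Variables (L : C -> D) (u : forall c : C, hom C c (G (L c))).
Hypothesis u_1 : forall (c : C) (d : D) (f : hom C c (G d)),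
  exists! h : hom D (L c) d, fmap G h · u c = f.
Hypothesis u_2 : forall (c : C) (d : D) (h k : hom D (L c) d)
    (α : hom2 (fmap G h · u c) (fmap G k · u c)),
  exists! φ : hom2 h k, fmap2 G φ ▹ u c = α.

Lemma transpose_inj (c : C) (d : D) (h k : hom D (L c) d) :
  fmap G h · u c = fmap G k · u c -> h = k.
Proof.
move=> E; case: (u_1 (fmap G k · u c)) => h0 [_ U].
by rewrite -(U h E) -(U k).
Qed.

Lemma transpose_cell_inj (c : C) (d : D) (x y : cells (L c) d) :
  wr (fc G x) (u c) = wr (fc G y) (u c) -> x = y.
Proof.
case: x => h k φ; case: y => h' k' ψ E.
have E1 := transpose_inj (f_equal cdom E).
have E2 := transpose_inj (f_equal ccod E).
subst h' k'; move: E => /= /Cell_inj E.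
case: (u_2 (fmap2 G ψ ▹ u c)) => φ0 [_ U].
by rewrite -(U φ E) -(U ψ).
Qed.

Lemma transpose_ex (c : C) (d : D) (f : hom C c (G d)) :
  {h : hom D (L c) d | fmap G h · u c = f}.
Proof.
apply: constructive_indefinite_description.
by case: (u_1 f) => h [E _]; exists h.
Qed.
Definition transpose (c : C) (d : D) (f : hom C c (G d)) : hom D (L c) d :=
  proj1_sig (transpose_ex f).
Lemma transposeE (c : C) (d : D) (f : hom C c (G d)) :
  fmap G (transpose f) · u c = f.
Proof. exact: proj2_sig (transpose_ex f). Qed.

Lemma transpose_cell_ex (c : C) (d : D) (h k : hom D (L c) d) (x : cells c (G d)) :
  cdom x = fmap G h · u c -> ccod x = fmap G k · u c ->
  {φ : hom2 h k | wr (fc G (Cell φ)) (u c) = x}.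
Proof.
move=> E1 E2; apply: constructive_indefinite_description.
case: (cell_retype E1 E2) => α <-.
by case: (u_2 α) => φ [<- _]; exists φ.
Qed.

Definition ladj_map (c c' : C) (f : hom C c c') : hom D (L c) (L c') :=
  transpose (u c' · f).
Lemma ladj_mapE (c c' : C) (f : hom C c c') :
  fmap G (ladj_map f) · u c = u c' · f.
Proof. exact: transposeE. Qed.

Lemma ladj_map2_ex (c c' : C) (f g : hom C c c') (α : hom2 f g) :
  {φ : hom2 (ladj_map f) (ladj_map g) |
    wr (fc G (Cell φ)) (u c) = wl (u c') (Cell α)}.
Proof. by apply: transpose_cell_ex; rewrite ladj_mapE. Qed.
Definition ladj_map2 (c c' : C) (f g : hom C c c') (α : hom2 f g) :
  hom2 (ladj_map f) (ladj_map g) := proj1_sig (ladj_map2_ex α).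
Lemma ladj_map2E (c c' : C) (f g : hom C c c') (α : hom2 f g) :
  wr (fc G (Cell (ladj_map2 α))) (u c) = wl (u c') (Cell α).
Proof. exact: proj2_sig (ladj_map2_ex α). Qed.

Lemma ladj_comp (a b c : C) (g : hom C b c) (f : hom C a b) :
  ladj_map (g · f) = ladj_map g · ladj_map f.
Proof.
apply: transpose_inj.
by rewrite fmap_comp -comp1_assoc !ladj_mapE !comp1_assoc ladj_mapE.
Qed.

Definition ladj : TwoFunctor C D.
Proof.
refine (@mkTwoFunctor C D L ladj_map ladj_map2 _ ladj_comp _ _ _).
- abstract (move=> a; apply: transpose_inj;
    by rewrite ladj_mapE fmap_id comp1_id_l comp1_id_r).
- abstract (move=> a b f; apply: Cell_inj; apply: transpose_cell_inj;
    by rewrite ladj_map2E -!/(ic _) wl_ic fc_ic wr_ic ladj_mapE).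
- abstract (move=> a b f g h β α; apply: Cell_inj; apply: transpose_cell_inj;
    by rewrite ladj_map2E !cell_vcomp fc_vc // wr_vc // wl_vc // !ladj_map2E).
- abstract (move=> a b c g g' f f' β α; apply: transpose_cell_inj;
    rewrite ladj_map2E !hcomp_wh !cell_vcomp !cell_wl !cell_wr
      fc_vc // !fc_wl !fc_wr wr_vc ?wr_wl ?ladj_map2E ?wr_wr ?ladj_mapE //;
    by rewrite -wr_wr ladj_map2E wl_vc // wl_wl wr_wl -ladj_mapE -wl_wl).
Defined.

Definition ladj_unit : TwoNat (idF C) (compF G ladj).
Proof.
refine (@mkTwoNat C C (idF C) (compF G ladj) u _ _).
- abstract (move=> a b f; exact: ladj_mapE).
- abstract (move=> a b f g α; exact: ladj_map2E).
Defined.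

Definition ladj_counit : TwoNat (compF ladj G) (idF D).
Proof.
refine (@mkTwoNat D D (compF ladj G) (idF D) (fun d => transpose (id1 (G d))) _ _).
- abstract (move=> a b f; apply: transpose_inj;
    by rewrite !fmap_comp -!comp1_assoc ladj_mapE transposeE
      comp1_assoc transposeE comp1_id_l comp1_id_r).
- abstract (move=> a b f g α; apply: transpose_cell_inj;
    by rewrite cell_wl cell_wr fc_wl fc_wr wr_wl wr_wr transposeE wr_id
      ladj_map2E wl_wl transposeE wl_id).
Defined.

Definition ladj_adj : TwoAdj ladj G.
Proof.
refine (@mkTwoAdj C D ladj G ladj_unit ladj_counit _ _).
- abstract (move=> c; apply: transpose_inj;
    by rewrite fmap_comp -comp1_assoc ladj_mapE comp1_assoc transposeE
      fmap_id !comp1_id_l).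
- abstract (move=> d; exact: transposeE).
Defined.

(** [h] is recovered from [G h · u a], which is [u b · f] for [f] the image of
    [h]; so when [u b] is invertible, [f] is forced to be [v · G h · u a].  The
    same formula, whiskered, works for 2-cells. *)
Lemma ladj_fully_faithful :
  (forall c : C, exists v : hom C (G (L c)) c, v · u c = id1 c /\ u c · v = id1 _) ->
  fully_faithful ladj.
Proof.
move=> inv; split=> [a b h | a b f g φ]; case: (inv b) => v [vu uv].
- exists (v · fmap G h · u a); split=> [|f /= <-].
  + by apply: transpose_inj; rewrite ladj_mapE comp1_assoc uv comp1_id_l.
  + by rewrite ladj_mapE comp1_assoc vu comp1_id_l.
- have E1 : cdom (wl v (wr (fc G (Cell φ)) (u a))) = f.
    by rewrite cdom_wl cdom_wr /= ladj_mapE comp1_assoc vu comp1_id_l.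
  have E2 : ccod (wl v (wr (fc G (Cell φ)) (u a))) = g.
    by rewrite ccod_wl ccod_wr /= ladj_mapE comp1_assoc vu comp1_id_l.
  case: (cell_retype E1 E2) => α E.
  exists α; split=> [|β /= Eβ]; apply: Cell_inj.
  + by apply: transpose_cell_inj; rewrite ladj_map2E E wl_wl uv wl_id.
  + by rewrite E -Eβ ladj_map2E wl_wl vu wl_id.
Qed.

End UniversalArrows.

(** * Codescent objects *)

(** Cocones and their universal property in terms of packed cells: in this form
    existence and uniqueness are available separately, and the equations can be
    rewritten without transporting 2-cells along equalities of boundaries. *)
Section CodescentCells.
Variables (C : TwoCat) (X0 X1 X2 : C).
Variables (r s t : hom C X2 X1) (v w : hom C X1 X0) (i : hom C X0 X1).
Variables (χ2 : cells X2 X0) (χ0 : cells X0 X0).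

Record cocone_cells (B : C) (k : hom C X0 B) (d : cells X1 B) : Prop := {
  cocone_dom : cdom d = k · w;
  cocone_cod : ccod d = k · v;
  cocone_cells_mul : vc (wr d s) (wl k χ2) = vc (wr d r) (wr d t);
  cocone_cells_unit : vc (wr d i) (wl k χ0) = ic k
}.

Record codescent_cells (A : C) (c : hom C X0 A) (g : cells X1 A) : Prop := {
  codescent_cocone : cocone_cells c g;
  codescent_hom_ex : forall (B : C) (k : hom C X0 B) (d : cells X1 B),
    cocone_cells k d -> exists h : hom C A B, h · c = k /\ wl h g = d;
  codescent_hom_ext : forall (B : C) (h k : hom C A B),
    h · c = k · c -> wl h g = wl k g -> h = k;
  codescent_cell_ex : forall (B : C) (h k : hom C A B) (x : cells X0 B),
    cdom x = h · c -> ccod x = k · c ->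
    vc (wl k g) (wr x w) = vc (wr x v) (wl h g) ->
    exists φ : hom2 h k, wr (Cell φ) c = x;
  codescent_cell_ext : forall (B : C) (x y : cells A B),
    cdom x = cdom y -> ccod x = ccod y -> wr x c = wr y c -> x = y
}.

End CodescentCells.

Notation data_cocone D := (cocone_cells (cd_r D) (cd_s D) (cd_t D)
  (cd_v D) (cd_w D) (cd_i D) (Cell (cd_chi2 D)) (Cell (cd_chi0 D))).
Notation data_codescent D := (codescent_cells (cd_r D) (cd_s D) (cd_t D)
  (cd_v D) (cd_w D) (cd_i D) (Cell (cd_chi2 D)) (Cell (cd_chi0 D))).

Section Codescent.
Variables (C : TwoCat) (D : LaxCohData C).

Lemma cells_of_cocone (A : C) (κ : Cocone D A) : data_cocone D (cc κ) (Cell (cg κ)).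
Proof. by split=> //; [move: (cocone_mul κ) | move: (cocone_unit κ)]; opn. Qed.

Lemma cocone_of_cells (B : C) (k : hom C (cd_X0 D) B) (d : cells (cd_X1 D) B) :
  data_cocone D k d -> exists κ : Cocone D B, cc κ = k /\ Cell (cg κ) = d.
Proof.
case=> E1 E2; case: (cell_retype E1 E2) => δ <- Em Eu.
unshelve eexists (@mkCocone C D B k δ _ _); by [|opn].
Qed.

(** Uniqueness for 1-cells out of the apex compares two factorizations of this
    cocone. *)
Definition cocone_post (A B : C) (h : hom C A B) (κ : Cocone D A) : Cocone D B.
Proof.
refine (@mkCocone C D B (h · cc κ) ⟨h ◃ cg κ⟩ _ _).
- abstract (move: (f_equal (wl h) (cocone_mul κ)); opn;
    absc (Cell (cg κ)) g; absc (Cell (cd_chi2 D)) x; push => E; by rewrite E).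
- abstract (move: (f_equal (wl h) (cocone_unit κ)); opn; rewrite -!/(ic _);
    absc (Cell (cg κ)) g; absc (Cell (cd_chi0 D)) x; push => E; by rewrite E).
Defined.

Lemma cells_of_codescent (A : C) (κ : Cocone D A) : is_codescent κ ->
  data_codescent D (cc κ) (Cell (cg κ)).
Proof.
move=> H; split.
- exact: cells_of_cocone.
- move=> B k d /cocone_of_cells [κ' [<- <-]].
  by case: (codescent_1 H κ') => h [E _]; exists h.
- move=> B h k E1 E2; case: (codescent_1 H (cocone_post k κ)) => h0 [_ U].
  have Uh : h0 = h by apply: U; split=> //; rewrite /heq /= cell_recast.
  have Uk : h0 = k by apply: U; split=> //; rewrite /heq /= cell_recast.
  by rewrite -Uh -Uk.
- move=> B h k x E1 E2; case: (cell_retype E1 E2) => θ <- E3.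
  have [|φ [<- _]] := @codescent_2 _ _ _ _ H B h k θ; last by exists φ.
  by opn.
- move=> B; case=> h k φ; case=> h' k' ψ /= E1 E2; subst h' k' => /Cell_inj E.
  have [|φ0 [_ U]] := @codescent_2 _ _ _ _ H B h k (ψ ▹ cc κ).
  + opn; have := vc_xch (Cell ψ) (Cell (cg κ)); push => /= E'.
    exact: eq_sym E'.
  + by rewrite -(U φ E) -(U ψ).
Qed.

Lemma codescent_of_cells (A : C) (κ : Cocone D A) :
  data_codescent D (cc κ) (Cell (cg κ)) ->
  is_codescent κ.
Proof.
move=> H; split.
- move=> B κ'; case: (codescent_hom_ex H (cells_of_cocone κ')) => h [E1 E2].
  exists h; split=> // h' [E1' E2'].
  by apply: (codescent_hom_ext H); rewrite ?E1 ?E1' // E2 -E2'.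
- move=> B h k θ; opn => E.
  case: (codescent_cell_ex H (eq_refl : cdom (Cell θ) = _) (eq_refl : ccod (Cell θ) = _) E).
  move=> φ Eφ; exists φ; split; first exact: Cell_inj.
  move=> ψ Eψ; apply: Cell_inj; apply: (codescent_cell_ext H) => //.
  by rewrite Eφ -Eψ.
Qed.

End Codescent.

Section MapCells.
Variables (C E : TwoCat) (F : TwoFunctor C E) (D : LaxCohData C).

Lemma map_chi2 : Cell (cd_chi2 (map_data F D)) = fc F (Cell (cd_chi2 D)).
Proof. exact: cell_recast. Qed.
Lemma map_chi0 : Cell (cd_chi0 (map_data F D)) = fc F (Cell (cd_chi0 D)).
Proof. exact: cell_recast. Qed.
Lemma map_cg (A : C) (κ : Cocone D A) :
  Cell (cg (map_cocone F κ)) = fc F (Cell (cg κ)).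
Proof. exact: cell_recast. Qed.

Lemma cells_of_map_codescent (A : C) (κ : Cocone D A) :
  is_codescent (map_cocone F κ) ->
  codescent_cells (fmap F (cd_r D)) (fmap F (cd_s D)) (fmap F (cd_t D))
    (fmap F (cd_v D)) (fmap F (cd_w D)) (fmap F (cd_i D))
    (fc F (Cell (cd_chi2 D))) (fc F (Cell (cd_chi0 D)))
    (fmap F (cc κ)) (fc F (Cell (cg κ))).
Proof. by move/cells_of_codescent; rewrite map_chi2 map_chi0 map_cg. Qed.

End MapCells.

(** * Strict algebras have codescent objects *)

Section StrictCodescent.
Variables (K : TwoCat) (T : TwoMonad K).
Notation U := (forget T).

(** Lets every equation between 2-cells of strict algebras be checked in the base
    2-category. *)
Lemma forget_cell_inj (A B : TAlgs T) (x y : cells A B) : fc U x = fc U y -> x = y.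
Proof.
case: x => f g α; case: y => f' g' β /= E.
have E1 := f_equal cdom E; have E2 := f_equal ccod E.
by apply: StrictCell_heq => //; apply: StrictMor_eq.
Qed.

Lemma strict_wr (D : LaxCohData (TAlgs T)) :
  sf (cd_w D) · sf (cd_r D) = sf (cd_v D) · sf (cd_t D).
Proof. exact (f_equal (fun f => sf f) (cd_wr D)). Qed.
Lemma strict_wr_r (D : LaxCohData (TAlgs T)) (X : K) (k : hom K X _) :
  sf (cd_w D) · sf (cd_r D) · k = sf (cd_v D) · sf (cd_t D) · k.
Proof. by rewrite !comp1_assoc strict_wr. Qed.
Lemma Tstrict_wr (D : LaxCohData (TAlgs T)) :
  fmap T (sf (cd_w D)) · fmap T (sf (cd_r D)) = fmap T (sf (cd_v D)) · fmap T (sf (cd_t D)).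
Proof. by rewrite -!fmap_comp strict_wr. Qed.
#[local] Hint Rewrite strict_wr strict_wr_r Tstrict_wr : bd.

(** Since [T C] and [T (T C)] are codescent objects along with [C], cells out of
    them are built and compared on coprojections; this is how the action on [C]
    arises and how its laws are checked. *)
Section Creation.
Variables (D : LaxCohData (TAlgs T)).
Notation X0 := (cd_X0 D).
Notation X1 := (cd_X1 D).
Notation r := (sf (cd_r D)).
Notation s := (sf (cd_s D)).
Notation t := (sf (cd_t D)).
Notation v := (sf (cd_v D)).
Notation w := (sf (cd_w D)).
Notation i := (sf (cd_i D)).
Notation χ2 := (Cell (sc (cd_chi2 D))).
Notation χ0 := (Cell (sc (cd_chi0 D))).

Lemma forget_cocone (B : TAlgs T) (k : hom (TAlgs T) X0 B) (d : cells X1 B) :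
  data_cocone D k d <->
  cocone_cells r s t v w i χ2 χ0 (sf k) (fc U d).
Proof.
have E : cdom d = k · cd_w D -> ccod d = k · cd_v D ->
  ccod (wl k (Cell (cd_chi2 D))) = cdom (wr d (cd_s D)) /\
  ccod (wr d (cd_t D)) = cdom (wr d (cd_r D)) /\
  ccod (wl k (Cell (cd_chi0 D))) = cdom (wr d (cd_i D)).
  move=> dd cd; rewrite !cdom_wr !ccod_wr !ccod_wl dd cd -!comp1_assoc.
  by rewrite cd_wr.
split=> [[dd cd Em Eu]|[dd cd Em Eu]].
- case: (E dd cd) => E1 [E2 E3].
  split.
  + exact (eq_trans (cdom_fc U d) (f_equal (fmap U) dd)).
  + exact (eq_trans (ccod_fc U d) (f_equal (fmap U) cd)).
  + by move: (f_equal (fc U) Em); rewrite !fc_vc // !fc_wr fc_wl.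
  + by move: (f_equal (fc U) Eu); rewrite !fc_vc // !fc_wr fc_wl.
- have dd' : cdom d = k · cd_w D.
    apply: StrictMor_eq; exact (eq_trans (eq_sym (cdom_fc U d)) dd).
  have cd' : ccod d = k · cd_v D.
    apply: StrictMor_eq; exact (eq_trans (eq_sym (ccod_fc U d)) cd).
  case: (E dd' cd') => E1 [E2 E3].
  split=> //; apply: forget_cell_inj.
  + by rewrite !fc_vc // !fc_wr fc_wl.
  + by rewrite !fc_vc // !fc_wr fc_wl.
Qed.

Variables (C : K) (c : hom K (sob X0) C) (g : cells (sob X1) C).
Hypothesis H : codescent_cells r s t v w i χ2 χ0 c g.
Hypothesis HT : codescent_cells (fmap T r) (fmap T s) (fmap T t)
  (fmap T v) (fmap T w) (fmap T i) (fc T χ2) (fc T χ0) (fmap T c) (fc T g).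
Hypothesis HTT : codescent_cells (fmap T (fmap T r)) (fmap T (fmap T s))
  (fmap T (fmap T t)) (fmap T (fmap T v)) (fmap T (fmap T w)) (fmap T (fmap T i))
  (fc T (fc T χ2)) (fc T (fc T χ0)) (fmap T (fmap T c)) (fc T (fc T g)).

(** Multiplying a cocone by the actions of [X0] and [X1] gives a cocone on the
    [T]-image of the diagram, because the 2-cells [χ2] and [χ0] are strict. *)
Lemma codescent_action :
  exists a : hom K (T C) C, a · fmap T c = c · sa X0 /\ wl a (fc T g) = wr g (sa X1).
Proof.
apply: (codescent_hom_ex HT).
case: (codescent_cocone H) => dg cg.
move=> /(f_equal (fun c => wr c (sa (cd_X2 D)))) + /(f_equal (fun c => wr c (sa X0))).
move: (s_cell (cd_chi2 D)) (s_cell (cd_chi0 D)); opn.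
absc (Cell (sc (cd_chi2 D))) x; absc (Cell (sc (cd_chi0 D))) y => Ex Ey Em Eu.
split; try bd.
- by move: Em; push; rewrite Ex wl_wl.
- by move: Eu; push; rewrite Ey wl_wl.
Qed.

(** The forgetful 2-functor creates the codescent object: the laws of the action
    [a] and the strictness of factorizations hold because they hold on
    coprojections, where they are the laws of the given algebras. *)
Lemma codescent_algebra : exists (A : StrictAlg T) (κ : Cocone D A),
  is_codescent κ /\ is_codescent (map_cocone U κ).
Proof.
case: codescent_action => a [ac ag].
have acr X (k : hom K X _) : a · fmap T c · k = c · sa X0 · k.
  by rewrite !comp1_assoc ac.
(* Unit and associativity of the action, tested out of [C] and [T (T C)]. *)
have Eu : a · e T C = id1 C.
  apply: (codescent_hom_ext H).
    by rewrite -comp1_assoc -e_nat acr s_unit comp1_id_l comp1_id_r.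
  by rewrite -wl_wl -wl_e -wr_wl ag wr_wr s_unit wr_id wl_id.
have Em : a · fmap T a = a · m T C.
  apply: (codescent_hom_ext HTT).
    by rewrite -!comp1_assoc -fmap_comp ac m_nat acr fmap_comp acr s_mul.
  by rewrite -!wl_wl -fc_wl ag wl_m fc_wr -!wr_wl ag !wr_wr s_mul.
pose A : TAlgs T := mkStrictAlg Em Eu.
pose c' : hom (TAlgs T) X0 A := @mkStrictMor K T X0 A c (eq_sym ac).
have [d Ed] : exists d : hom2 (c · w) (c · v), Cell d = g.
  by case: (codescent_cocone H) => d1 d2 _ _; exact: cell_retype.
have dP : d ▹ sa X1 ≈ a ◃ fmap2 T d by opn; rewrite Ed.
pose d' : hom2 (c' · cd_w D) (c' · cd_v D) :=
  @mkStrictCell K T X1 A (c' · cd_w D) (c' · cd_v D) d dP.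
have /cocone_of_cells [κ [Ec Eg]] :
    data_cocone D c' (Cell d').
  by apply/forget_cocone; rewrite /= Ed; exact: codescent_cocone H.
exists A, κ; split; apply: codescent_of_cells; last first.
  by move: (f_equal (fc U) Eg); rewrite /= => ->; rewrite Ec Ed; exact: H.
rewrite Eg Ec; split; first by rewrite -Eg -Ec; exact: cells_of_cocone.
- move=> B k d0 /forget_cocone Hk; case: (codescent_hom_ex H Hk) => h [hc hg].
  (* The factorization below is strict: both sides agree on [T C]. *)
  have hP : h · a = sa B · fmap T h.
    apply: (codescent_hom_ext HT).
      by rewrite -!comp1_assoc -fmap_comp ac comp1_assoc hc s_mor.
    rewrite -!wl_wl -fc_wl ag hg -wr_wl hg.
    by case: (d0) => ? ? d1; exact: s_cell d1.
  exists (@mkStrictMor K T A B h hP); split; first exact: StrictMor_eq.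
  apply: forget_cell_inj; rewrite -hg -Ed; exact: fc_wl.
- move=> B h k Ec' Eg'; apply: StrictMor_eq; apply: (codescent_hom_ext H).
  + exact: (f_equal (fun f => sf f) Ec').
  + by move: (f_equal (fc U) Eg'); rewrite /= !cell_wl Ed.
- move=> B h k x E1 E2; case: (cell_retype E1 E2) => θ <- /(f_equal (fc U)).
  rewrite !fc_vc; [exact: eq_sym (comp1_assoc _ _ _) | exact: comp1_assoc |].
  rewrite !fc_wl !fc_wr => E3.
  have E : vc (wl (sf k) g) (wr (Cell (sc θ)) w) =
      vc (wr (Cell (sc θ)) v) (wl (sf h) g) by rewrite -Ed; exact: E3.
  have [φ Eφ] := codescent_cell_ex H (x := Cell (sc θ)) eq_refl eq_refl E.
  have φP : φ ▹ sa A ≈ sa B ◃ fmap2 T φ.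
    apply: (codescent_cell_ext HT); [exact (s_mor h) | exact (s_mor k) |].
    rewrite cell_wr cell_wl wr_wr ac -wr_wr Eφ wr_wl cell_fmap2 -fc_wr Eφ.
    exact: s_cell θ.
  exists (@mkStrictCell K T A B h k φ φP); exact: forget_cell_inj.
- move=> B x y E1 E2 E; apply: forget_cell_inj; apply: (codescent_cell_ext H).
  + by move: (f_equal (fmap U) E1); rewrite -!cdom_fc.
  + by move: (f_equal (fmap U) E2); rewrite -!ccod_fc.
  + by move: (f_equal (fc U) E); rewrite !fc_wr.
Qed.

End Creation.

Lemma strict_codescent (D : LaxCohData (TAlgs T)) :
  has_codescent K -> preserves_codescent T ->
  exists (A : StrictAlg T) (κ : Cocone D A),
    is_codescent κ /\ is_codescent (map_cocone U κ).
Proof.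
move=> hK hT; case: (hK (map_data U D)) => C [κ Hκ].
have HT := hT _ _ _ Hκ; have HTT := hT _ _ _ HT.
move/cells_of_codescent: Hκ => H.
move/cells_of_map_codescent: HT => HT; move/cells_of_map_codescent: HTT => HTT.
rewrite map_cg !map_chi2 !map_chi0 in H HT HTT.
exact: codescent_algebra H HT HTT.
Qed.

End StrictCodescent.

(** * The colax morphism classifier *)

Section Classifier.
Variables (K : TwoCat) (T : TwoMonad K) (X : LaxAlg T).
Notation x := (lx X).
Notation ξ2 := (Cell (lxi2 X)).
Notation ξ0 := (Cell (lxi0 X)).
Variables (Q : TAlgs T) (κ : Cocone (coherence_data X) Q).
Notation b := (sa Q).

Lemma coherence_chi2 : Cell (sc (cd_chi2 (coherence_data X))) = fc T ξ2.
Proof. exact: cell_recast. Qed.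
Lemma coherence_chi0 : Cell (sc (cd_chi0 (coherence_data X))) = fc T ξ0.
Proof. exact: cell_recast. Qed.

Definition cl_g : hom K (T X) (sob Q) := sf (cc κ).
Definition cl_γ : cells (T (T X)) (sob Q) := Cell (sc (cg κ)).

Lemma cl_g_mor : cl_g · m T X = b · fmap T cl_g.
Proof. exact (s_mor (cc κ)). Qed.
Lemma cl_γ_mor : wr cl_γ (m T (T X)) = wl b (fc T cl_γ).
Proof. exact (s_cell (cg κ)). Qed.

Lemma cl_cocone : cocone_cells (m T (T X)) (fmap T (m T X)) (fmap T (fmap T x))
  (m T X) (fmap T x) (fmap T (e T X)) (fc T ξ2) (fc T ξ0) cl_g cl_γ.
Proof.
have /forget_cocone := cells_of_cocone κ.
by rewrite coherence_chi2 coherence_chi0.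
Qed.

Lemma classifier_unit_dom : (cl_g · fmap T x) · e T (T X) = (cl_g · e T X) · x.
Proof. bd. Qed.
Lemma classifier_unit_cod : (cl_g · m T X) · e T (T X) = b · fmap T (cl_g · e T X).
Proof. by rewrite fmap_comp [RHS]comp1_assoc -cl_g_mor -!comp1_assoc meT mTe. Qed.

(** The restriction of the cocone along the unit of the monad.  Its two laws are
    the cocone equations whiskered with a unit; strictness of [γ] turns
    [b · T (γ e)] back into [γ]. *)
Definition classifier_unit : ColaxMor X (lax_of_strict Q).
Proof.
refine (@mkColaxMor K T X (lax_of_strict Q) (cl_g · e T X)
  (recast (sc (cg κ) ▹ e T (T X)) classifier_unit_dom classifier_unit_cod) _ _).
- case: cl_cocone => dg cg Em _.
  opn. rewrite -/cl_γ.
  have := f_equal (fun c => wr c (e T (T (T X)))) Em.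
  absc (Cell (lxi2 X)) u. push; rewrite wl_e wl_wl => ->.
  rewrite -[lx (lax_of_strict Q)]/b -wr_wl -cl_γ_mor wr_wr mTe wr_id vc_id_l //.
  rewrite ccod_vc; first by bd.
  by rewrite cg [RHS]comp1_assoc -cl_g_mor -comp1_assoc mTe_r.
- case: cl_cocone => dg cg _ Eu.
  opn. rewrite -/cl_γ.
  have := f_equal (fun c => wr c (e T X)) Eu.
  absc (Cell (lxi0 X)) u. by push; rewrite wl_e wl_wl.
Defined.

Lemma cbar_classifier_unit : Cell (cbar classifier_unit) = wr cl_γ (e T (T X)).
Proof. exact: cell_recast. Qed.

Lemma cbar_incl_comp (A : TAlgs T) (h : hom (TAlgs T) Q A) :
  Cell (cbar (colax_comp (incl_mor h) classifier_unit)) = wl (sf h) (wr cl_γ (e T (T X))).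
Proof.
rewrite /= cell_recast cell_paste cell_wr cell_wl cbar_classifier_unit cell_eqcell.
rewrite wr_ic vc_id_l // ccod_wl ccod_wr.
case: cl_cocone => _ -> _ _; rewrite classifier_unit_cod; bd.
Qed.

(** Strict morphisms and cells out of free algebras are recovered from their
    restriction along the unit of the monad; here for composites with the cocone. *)
Lemma strict_mor_restrict_ext (A : TAlgs T) (h : hom (TAlgs T) Q A) :
  sa A · fmap T (sf h · cl_g · e T X) = sf h · cl_g.
Proof.
by rewrite !fmap_comp comp1_assoc -s_mor -comp1_assoc [b · _]comp1_assoc -cl_g_mor
  -comp1_assoc mTe comp1_id_r.
Qed.
Lemma strict_mor_cell_restrict_ext (A : TAlgs T) (h : hom (TAlgs T) Q A) :
  wl (sa A) (fc T (wl (sf h) (wr cl_γ (e T (T X))))) = wl (sf h) cl_γ.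
Proof.
by rewrite fc_wl fc_wr wl_wl -s_mor -wl_wl -wr_wl -cl_γ_mor wr_wr mTe wr_id.
Qed.

Lemma strict_cell_restrict_ext (A : TAlgs T) (h k : hom (TAlgs T) Q A) (φ : hom2 h k) :
  wl (sa A) (fc T (wr (Cell (sc φ)) (cl_g · e T X))) = wr (Cell (sc φ)) cl_g.
Proof.
have Eφ : wr (Cell (sc φ)) b = wl (sa A) (fc T (Cell (sc φ))) by exact (s_cell φ).
by rewrite fc_wr -wr_wl -Eφ wr_wr fmap_comp comp1_assoc -cl_g_mor -comp1_assoc mTe comp1_id_r.
Qed.

Variable H : is_codescent κ.

Lemma incl_comp_inj (A : TAlgs T) (h k : hom (TAlgs T) Q A) :
  colax_comp (incl_mor h) classifier_unit = colax_comp (incl_mor k) classifier_unit ->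
  h = k.
Proof.
move=> E; apply: (codescent_hom_ext (cells_of_codescent H)).
- apply: StrictMor_eq. rewrite /= -/cl_g -!strict_mor_restrict_ext.
  by have /= -> := f_equal (fun F => cf F) E.
- apply: forget_cell_inj; rewrite !fc_wl.
  have := f_equal (fun F => Cell (cbar F)) E; rewrite !cbar_incl_comp => E'.
  have := strict_mor_cell_restrict_ext h; rewrite E' strict_mor_cell_restrict_ext. exact: eq_sym.
Qed.

Definition free_ext (A : TAlgs T) (f : hom K X (sob A)) : hom (TAlgs T) (free T X) A :=
  strict_comp (@mkStrictMor K T (free T A) A (sa A) (eq_sym (s_mul A))) (free_mor T f).

(** The inverse passage: a colax morphism [(f, f̄)] into a strict algebra [(A, a)]
    extends freely to the cocone [(a Tf, a T f̄)], and the laws of a colax morphism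
    become the cocone equations. *)
Lemma colax_cocone (A : TAlgs T) (F : ColaxMor X (lax_of_strict A)) :
  exists κ' : Cocone (coherence_data X) A,
    cc κ' = free_ext (cf F) /\ Cell (sc (cg κ')) = wl (sa A) (fc T (Cell (cbar F))).
Proof.
pose k := free_ext (cf F).
have E1 : cdom (wl (sa A) (fc T (Cell (cbar F)))) = sf k · fmap T x by bd.
have E2 : ccod (wl (sa A) (fc T (Cell (cbar F)))) = sf k · m T X by bd.
case: (cell_retype E1 E2) => d0 Ed.
have dP : d0 ▹ m T (T X) ≈ sa A ◃ fmap2 T d0.
  by opn; rewrite Ed fc_wl wl_wl s_mul wr_wl -wl_m wl_wl.
pose d : hom2 (k · cd_w (coherence_data X)) (k · cd_v (coherence_data X)) :=
  @mkStrictCell K T (free T (T X)) A (k · cd_w (coherence_data X))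
   (k · cd_v (coherence_data X)) d0 dP.
have /cocone_of_cells [κ' [Ec Eg]] : data_cocone (coherence_data X)
  k (Cell d).
  apply/forget_cocone.
  rewrite coherence_chi2 coherence_chi0 /= Ed.
  move: (colax_mul F) (colax_unit F); opn. absc (Cell (cbar F)) Fb => Em Eu.
  rewrite -!/(ic _) -[lx (lax_of_strict A)]/(sa A) in Em Eu.
  absc (Cell (lxi2 X)) u; absc (Cell (lxi0 X)) u'.
  split; [bd | bd | |].
    move: (f_equal (fun c => wl (sa A) (fc T c)) Em); push => ->.
    by rewrite s_mul -wl_m wl_wl.
  by move: (f_equal (fun c => wl (sa A) (fc T c)) Eu); push.
exists κ'; split=> //; rewrite -Ed; exact (f_equal (fc (forget T)) Eg).
Qed.

(** Existence factors the cocone of [F] through [Q]; naturality of the unit shows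
    that restricting the cocone of [F] gives back [F]. *)
Lemma classifier_universal_1 (A : TAlgs T) (F : ColaxMor X (lax_of_strict A)) :
  exists! h : hom (TAlgs T) Q A, colax_comp (incl_mor h) classifier_unit = F.
Proof.
case: (colax_cocone F) => κ' [Ec Eg].
case: (codescent_1 H κ') => h [[hc hg] _]; exists h.
have hc' : sf h · cl_g = sa A · fmap T (cf F).
  exact (f_equal (fun f => sf f) (eq_trans hc Ec)).
have hg' : wl (sf h) cl_γ = wl (sa A) (fc T (Cell (cbar F))).
  rewrite -Eg; exact (f_equal (fc (forget T)) hg).
have E : colax_comp (incl_mor h) classifier_unit = F.
  apply: ColaxMor_eq; first by rewrite /= comp1_assoc hc' -comp1_assoc e_nat s_unit_r.
  by rewrite /heq cbar_incl_comp -wr_wl hg' wr_wl wl_e wl_wl s_unit wl_id.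
by split=> // k Ek; apply: incl_comp_inj; rewrite Ek.
Qed.

(** As for 1-cells, [α] extends freely to [θ = a T α] between composites with
    [g].  The compatibility of [θ] with [γ] is the law of a colax 2-cell for
    [α], after applying [a T (-)]. *)
Lemma classifier_universal_2 (A : TAlgs T) (h k : hom (TAlgs T) Q A)
    (α : ColaxCell (colax_comp (incl_mor h) classifier_unit)
                   (colax_comp (incl_mor k) classifier_unit)) :
  exists! φ : StrictCell h k,
    @rwhisk (LaxTAlgc T) _ _ _ _ _ (fmap2 (incl T) φ) classifier_unit = α.
Proof.
have caE (φ : StrictCell h k) :
    Cell (ca (@rwhisk (LaxTAlgc T) _ _ _ _ _ (fmap2 (incl T) φ) classifier_unit)) =
    wr (Cell (sc φ)) (cl_g · e T X) by [].
have E1 : cdom (wl (sa A) (fc T (Cell (ca α)))) = sf h · cl_g.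
  exact: strict_mor_restrict_ext.
have E2 : ccod (wl (sa A) (fc T (Cell (ca α)))) = sf k · cl_g.
  exact: strict_mor_restrict_ext.
case: (cell_retype E1 E2) => θ0 Eθ.
have θP : θ0 ▹ m T X ≈ sa A ◃ fmap2 T θ0.
  by opn; rewrite Eθ fc_wl wl_wl s_mul wr_wl -wl_m wl_wl.
pose θ : hom2 (h · cc κ) (k · cc κ) :=
  @mkStrictCell K T (free T X) A (strict_comp h (cc κ)) (strict_comp k (cc κ)) θ0 θP.
case: (codescent_2 H (B := A) (h := h) (k := k) (θ := θ)).
  opn; apply: forget_cell_inj.
  rewrite !fc_vc; [exact: eq_sym (comp1_assoc _ _ _) | exact: comp1_assoc |].
  rewrite !fc_wl !fc_wr /= -/cl_γ.
  suff E3 : vc (wl (sf k) cl_γ) (wr (Cell θ0) (fmap T x)) =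
      vc (wr (Cell θ0) (m T X)) (wl (sf h) cl_γ) by exact: E3.
  have := f_equal Cell (colax_cell α).
  rewrite !cell_vcomp !cbar_incl_comp.
  move/(f_equal (fun c => wl (sa A) (fc T c))).
  rewrite cell_wl cell_wr cell_fmap2 -[lx (lax_of_strict A)]/(sa A) Eθ.
  have Fh := strict_mor_cell_restrict_ext h; have Fk := strict_mor_cell_restrict_ext k.
  move: Fh Fk; case: cl_cocone => dg cg _ _.
  absc (Cell (ca α)) u.
  move: (cl_γ) dg cg => γ dg cg Fh Fk.
  rewrite !fc_vc; [bd | rewrite E1; bd |].
  rewrite !wl_vc; [bd | |].
    by rewrite cdom_fc ccod_fc E1 ccod_wl ccod_wr cg -comp1_assoc meT comp1_id_r.
  rewrite Fh Fk fc_wr -wr_wl => ->.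
  by rewrite fc_wl wl_wl s_mul -wl_wl wl_m wr_wl.
move=> φ [Eφ U]; exists φ; split.
  apply: ColaxCell_eq; apply: Cell_inj; rewrite caE.
  have Eφ' : wr (Cell (sc φ)) cl_g = wl (sa A) (fc T (Cell (ca α))).
    by rewrite -Eθ; exact (f_equal (fun c => Cell (sc c)) Eφ).
  by rewrite -wr_wr Eφ' wr_wl wl_e wl_wl s_unit wl_id.
move=> ψ Eψ; apply: U. apply: StrictCell_eq; apply: Cell_inj.
have {}Eψ := f_equal (fun c => Cell (ca c)) Eψ. rewrite caE in Eψ.
rewrite [RHS]Eθ -Eψ; exact (eq_sym (strict_cell_restrict_ext ψ)).
Qed.

Hypothesis HU : is_codescent (map_cocone (forget T) κ).
Notation p := (cf classifier_unit).

Lemma forget_codescent : codescent_cells (m T (T X)) (fmap T (m T X))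
  (fmap T (fmap T x)) (m T X) (fmap T x) (fmap T (e T X)) (fc T ξ2) (fc T ξ0) cl_g cl_γ.
Proof.
have := cells_of_map_codescent HU.
have -> : fc (forget T) (Cell (cd_chi2 (coherence_data X))) = fc T ξ2.
  exact: coherence_chi2.
by have -> : fc (forget T) (Cell (cd_chi0 (coherence_data X))) = fc T ξ0
  by exact: coherence_chi0.
Qed.

(** Associativity and one unit law of the lax algebra say that [(x, ξ²)] is a
    cocone in the base 2-category; it need not be one of strict morphisms. *)
Lemma classifier_retraction :
  exists q : hom K (sob Q) X, q · cl_g = x /\ wl q cl_γ = ξ2.
Proof.
apply: (codescent_hom_ex forget_codescent); split=> //.
- by move: (lax_assoc X); opn.
- by move: (lax_unit_T X); opn.
Qed.

(** Since [p q g = g e x = g · Tx · e], the 2-cell [γ e] has the boundary of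
    [ε g]; that it descends to a counit is the multiplication law of the cocone,
    restricted along [e]. *)
Lemma classifier_counit (q : hom K (sob Q) X) : q · cl_g = x -> wl q cl_γ = ξ2 ->
  exists ε : hom2 (p · q) (id1 (sob Q)), wr (Cell ε) cl_g = wr cl_γ (e T (T X)).
Proof.
move=> qg qγ; apply: (codescent_cell_ex forget_codescent).
- by rewrite cdom_wr (cocone_dom cl_cocone) -!comp1_assoc qg; bd.
- by rewrite ccod_wr (cocone_cod cl_cocone) -!comp1_assoc meT; bd.
- case: cl_cocone => dg cg Em _.
  have := f_equal (fun c => wr c (e T (T (T X)))) Em.
  rewrite -[wl (p · q) _]wl_wl qγ [p]/=.
  absc (Cell (lxi2 X)) u; push.
  by rewrite wl_e wl_wl.
Qed.

(** The triangle for [p] is the unit law of the cocone, restricted along [e].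
    The triangle for [q] is tested on [g], where it is the remaining unit law of
    the lax algebra. *)
Lemma classifier_adjunction : exists (q : hom K (sob Q) X) (adj : Adjunction p q),
  q · cl_g = x /\ wl q cl_γ = ξ2 /\ adj_unit adj ≈ lxi0 X /\
  wr (Cell (adj_counit adj)) cl_g = wr cl_γ (e T (T X)).
Proof.
case: classifier_retraction => q [qg qγ].
case: (classifier_counit qg qγ) => ε Eε.
have E : x · e T X = q · p by rewrite -qg -comp1_assoc.
unshelve eexists q, (@mkAdjunction K _ _ p q (recast (lxi0 X) eq_refl E) ε _ _).
- case: cl_cocone => dg cg _ Eu; opn.
  have := f_equal (fun c => wr c (e T X)) Eu.
  rewrite [p]/= -[wr (Cell ε) _]wr_wr Eε.
  absc (Cell (lxi0 X)) u; push.
  by rewrite wl_e wl_wl.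
- have B : ccod (wr ξ0 q) = cdom (wl q (Cell ε)).
    by rewrite ccod_wr cdom_wl [ccod _]/= E -comp1_assoc.
  opn; apply: (codescent_cell_ext forget_codescent).
  + by rewrite cdom_vc // cdom_wr [cdom _]/= comp1_id_l.
  + by rewrite ccod_vc // ccod_wl [ccod _]/= comp1_id_r.
  + move: (lax_unit_l X); opn => Eu.
    rewrite wr_vc // wr_wl Eε -wr_wl qγ wr_wr qg Eu.
    by rewrite -!/(ic _) wr_ic qg.
- by split=> //; split=> //; split=> //; exact: cell_recast.
Qed.

End Classifier.

(** * Lax doctrinal adjunctions *)

Section LDACounit.
Variables (K : TwoCat) (T : TwoMonad K).

Section Counit.
Variable L : LDAdj T.
Notation a := (sa (lda_alg L)).
Notation l := (lda_l L).
Notation r := (lda_r L).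
Notation ε := (adj_counit (lda_adj L)).
Notation η := (adj_unit (lda_adj L)).

(** The left adjoint as a colax morphism.  The mate correspondence along
    [l ⊣ r] sends the identity of [r a Tl] to this 2-cell [ε (a Tl)]. *)
Definition lda_counit : ColaxMor (lax_of_lda L) (lax_of_strict (lda_alg L)).
Proof.
refine (@mkColaxMor K T (lax_of_lda L) (lax_of_strict (lda_alg L)) l
  ⟨ε ▹ (a · fmap T l)⟩ _ _).
- abstract (rewrite /= /lda_xi2; opn; absc (Cell ε) E;
    have := vc_xch E (wl a (wr (fc T E) (fmap T a · fmap T (fmap T l))));
    rewrite !cdom_wl !ccod_wl !cdom_wr !ccod_wr !cdom_fc !ccod_fc dE cE;
    rewrite -!/(ic _);
    push => ->; by push).
- abstract (rewrite /= /lda_xi0; move: (adj_triangle_l (lda_adj L)); opn;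
    absc (Cell ε) E; absc (Cell η) H; rewrite -!/(ic _); by push).
Defined.

Lemma cbar_counit_comp (Y : LaxAlg T) (F : ColaxMor Y (lax_of_lda L)) :
  Cell (cbar (colax_comp lda_counit F)) =
  vc (wr (Cell ε) (a · fmap T l · fmap T (cf F))) (wl l (Cell (cbar F))).
Proof.
rewrite /=; opn; absc (Cell ε) E; absc (Cell (cbar F)) F'; by push.
Qed.

(** The 2-cell of a colax morphism into the induced lax algebra is the mate of
    that of its composite with [lda_counit]. *)
Lemma cbar_mate (Y : LaxAlg T) (F : ColaxMor Y (lax_of_lda L)) :
  Cell (cbar F) = vc (wl r (Cell (cbar (colax_comp lda_counit F))))
                     (wr (Cell η) (cf F · lx Y)).
Proof.
rewrite cbar_counit_comp; move: (adj_triangle_r (lda_adj L)); opn.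
absc (Cell ε) E; absc (Cell η) H; absc (Cell (cbar F)) F'; rewrite -!/(ic _) => E1.
have := vc_xch H F'.
have := f_equal (fun c => wr c (a · fmap T l · fmap T (cf F))) E1.
rewrite dF' cF' dH cH; push => E2 E3.
rewrite -E3; pre E2; by push.
Qed.

Lemma counit_comp_inj (Y : LaxAlg T) (F G : ColaxMor Y (lax_of_lda L)) :
  cf F = cf G -> colax_comp lda_counit F = colax_comp lda_counit G -> F = G.
Proof. by move=> E1 E2; apply: ColaxMor_eq => //; rewrite /heq !cbar_mate E1 E2. Qed.

End Counit.

(** The structure 2-cell of [colax_of_ld φ] is a mate by construction; composing
    with the counit undoes this by a triangle identity. *)
Lemma lda_counit_nat (L M : LDAdj T) (φ : LDMor L M) :
  colax_comp (lda_counit M) (colax_of_ld φ) =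
  colax_comp (incl_mor (ld2 φ)) (lda_counit L).
Proof.
apply: ColaxMor_eq; first exact: ld_comm.
rewrite /heq cbar_counit_comp /= /lda_bar; move: (adj_triangle_l (lda_adj M)); opn.
absc (Cell (adj_counit (lda_adj L))) E; absc (Cell (adj_counit (lda_adj M))) E'.
absc (Cell (adj_unit (lda_adj M))) H; rewrite -!/(ic _) => E1.
pose al := sa (lda_alg L) · fmap T (lda_l L).
have := vc_xch E' (wl (sf (ld2 φ)) (wr E al)).
have := f_equal (fun c => wr c (ld1 φ · lda_r L · al)) E1.
rewrite {}/al !cdom_wl !ccod_wl !cdom_wr !ccod_wr dE cE dE' cE'; push => E2 E3.
by pre E3; push; rewrite E2; push.
Qed.

End LDACounit.

(** Strict morphisms of lax algebras, as colax morphisms: they compare lax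
    algebras whose structures are equal but not convertible. *)
Section StrictColax.
Variables (K : TwoCat) (T : TwoMonad K) (X Y : LaxAlg T) (f : hom K X Y).
Hypothesis E : f · lx X = lx Y · fmap T f.
Hypothesis E2 : f ◃ lxi2 X ≈ lxi2 Y ▹ fmap T (fmap T f).
Hypothesis E0 : f ◃ lxi0 X ≈ lxi0 Y ▹ f.

Lemma strict_colax_mul : (eqcell E ▹ m T X) • (f ◃ lxi2 X) ≈
  (lxi2 Y ▹ fmap T (fmap T f)) • (lx Y ◃ fmap2 T (eqcell E)) • (eqcell E ▹ fmap T (lx X)).
Proof.
have Er Z (k : hom K Z _) : f · lx X · k = lx Y · fmap T f · k.
  by rewrite !comp1_assoc E.
have ET : fmap T f · fmap T (lx X) = fmap T (lx Y) · fmap T (fmap T f).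
  by rewrite -!fmap_comp E.
move: E2; opn => ->; absc (Cell (lxi2 Y)) u.
rewrite !fc_ic !wr_ic wl_ic fmap_comp !vc_id_l ?vc_id_r //;
  by rewrite ?ccod_wr ?cdom_wr ?du ?cu -?comp1_assoc ?Er ?ET ?m_nat.
Qed.

Lemma strict_colax_unit : (eqcell E ▹ e T X) • (f ◃ lxi0 X) ≈ lxi0 Y ▹ f.
Proof.
have Er Z (k : hom K Z _) : f · lx X · k = lx Y · fmap T f · k.
  by rewrite !comp1_assoc E.
move: E0; opn => ->; absc (Cell (lxi0 Y)) u.
rewrite !wr_ic vc_id_l //; by rewrite ccod_wr cu -!comp1_assoc Er e_nat.
Qed.

Definition strict_colax : ColaxMor X Y := mkColaxMor strict_colax_mul strict_colax_unit.

Lemma cbar_strict_colax : Cell (cbar strict_colax) = ic (f · lx X).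
Proof. exact: cell_eqcell. Qed.

End StrictColax.

Section ClassifierLDA.
Variables (K : TwoCat) (T : TwoMonad K) (X : LaxAlg T) (Q : TAlgs T)
  (κ : Cocone (coherence_data X) Q).
Hypothesis H : is_codescent κ.
Notation g := (cl_g κ).
Notation γ := (cl_γ κ).
Notation p := (cf (classifier_unit κ)).
Variables (q : hom K (sob Q) X) (adj : Adjunction p q).
Hypothesis qg : q · g = lx X.
Hypothesis qγ : wl q γ = Cell (lxi2 X).
Hypothesis adj0 : adj_unit adj ≈ lxi0 X.
Hypothesis adjε : wr (Cell (adj_counit adj)) g = wr γ (e T (T X)).

(** From here on [p ⊣ q] is regarded as a lax doctrinal adjunction, whose induced
    lax algebra is compared with [X]. *)
Definition classifier_lda : LDAdj T := mkLDAdj adj.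
Notation L := classifier_lda.

Lemma cl_action : sa Q · fmap T p = g.
Proof. by rewrite /= fmap_comp comp1_assoc -cl_g_mor -comp1_assoc mTe comp1_id_r. Qed.

Lemma classifier_lx : lx (lax_of_lda L) = lx X.
Proof. by rewrite -qg -cl_action. Qed.

(** The multiplication of the induced lax algebra is the whiskering of [b T(ε g)]
    by [q], and [b T(ε g) = b T(γ e) = γ] by strictness of [γ]. *)
Lemma classifier_lxi2 : lxi2 (lax_of_lda L) ≈ lxi2 X.
Proof.
rewrite /heq -qγ [LHS]cell_recast cell_wl cell_wr cell_fmap2.
rewrite [lda_r L]/= [lda_alg L]/= [lda_l L]/=.
rewrite -fmap_comp cl_action -fc_wr adjε.
by rewrite -wl_wl fc_wr -wr_wl -cl_γ_mor wr_wr mTe wr_id.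
Qed.

Lemma classifier_lxi0 : lxi0 (lax_of_lda L) ≈ lxi0 X.
Proof. by rewrite /heq -adj0 /= /lda_xi0; opn. Qed.

Definition lda_unit : ColaxMor X (lax_of_lda L).
Proof.
refine (@strict_colax K T X (lax_of_lda L) (id1 X) _ _ _).
- abstract (by rewrite classifier_lx comp1_id_l fmap_id comp1_id_r).
- abstract (rewrite /heq cell_wl cell_wr wl_id !fmap_id;
    exact (eq_sym (eq_trans (wr_id _) classifier_lxi2))).
- abstract (rewrite /heq cell_wl cell_wr wl_id; exact (eq_sym (eq_trans (wr_id _) classifier_lxi0))).
Defined.

Definition lda_unit_inv : ColaxMor (lax_of_lda L) X.
Proof.
refine (@strict_colax K T (lax_of_lda L) X (id1 X) _ _ _).
- abstract (by rewrite classifier_lx comp1_id_l fmap_id comp1_id_r).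
- abstract (rewrite /heq cell_wl cell_wr !fmap_id wr_id; exact (eq_trans (wl_id _) classifier_lxi2)).
- abstract (rewrite /heq cell_wl cell_wr wr_id; exact (eq_trans (wl_id _) classifier_lxi0)).
Defined.

Lemma cbar_lda_unit : Cell (cbar lda_unit) = ic (id1 X · lx X).
Proof. exact: cbar_strict_colax. Qed.
Lemma cbar_lda_unit_inv : Cell (cbar lda_unit_inv) = ic (id1 X · lx (lax_of_lda L)).
Proof. exact: cbar_strict_colax. Qed.

Lemma lda_unit_invK : colax_comp lda_unit_inv lda_unit = colax_id X.
Proof.
apply: ColaxMor_eq; first exact: comp1_id_l.
rewrite /heq [LHS]cell_recast [RHS]cell_recast cell_paste cell_wr cell_wl.
rewrite cbar_lda_unit cbar_lda_unit_inv.
by rewrite wr_ic wl_ic fmap_id comp1_id_r !comp1_id_l classifier_lx vc_id_l.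
Qed.

Lemma lda_unitK : colax_comp lda_unit lda_unit_inv = colax_id (lax_of_lda L).
Proof.
apply: ColaxMor_eq; first exact: comp1_id_l.
rewrite /heq [LHS]cell_recast [RHS]cell_recast cell_paste cell_wr cell_wl.
rewrite cbar_lda_unit cbar_lda_unit_inv.
by rewrite wr_ic wl_ic fmap_id comp1_id_r !comp1_id_l classifier_lx vc_id_l.
Qed.

(** On underlying 1-cells this is [p · 1 = p]; on 2-cells it is the
    characterization [ε g = γ e] of the counit. *)
Lemma counit_lda_unit : colax_comp (lda_counit L) lda_unit = classifier_unit κ.
Proof.
apply: ColaxMor_eq; first exact: comp1_id_r.
rewrite /heq cbar_classifier_unit cbar_counit_comp cbar_lda_unit.
rewrite -[cf lda_unit]/(id1 (lob X)) fmap_id comp1_id_r.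
rewrite -[lda_l L]/p -[lda_alg L]/Q cl_action -[lda_adj L]/adj adjε.
rewrite wl_ic comp1_id_l vc_id_r // cdom_wr (cocone_dom (cl_cocone κ)).
exact: classifier_unit_dom.
Qed.

Lemma counit_unit_comp (M : LDAdj T) (φ : LDMor L M) :
  colax_comp (lda_counit M) (colax_comp (colax_of_ld φ) lda_unit) =
  colax_comp (incl_mor (ld2 φ)) (classifier_unit κ).
Proof. by rewrite colax_comp_assoc lda_counit_nat -colax_comp_assoc counit_lda_unit. Qed.

(** The strict part of the morphism classifies [lda_counit M ∘ F]; both parts
    are then forced, and the equation holds because composition with
    [lda_counit M] reflects it. *)
Lemma lda_unit_universal_1 (M : LDAdj T) (F : ColaxMor X (lax_of_lda M)) :
  exists! φ : LDMor L M, colax_comp (colax_of_ld φ) lda_unit = F.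
Proof.
case: (classifier_universal_1 H (colax_comp (lda_counit M) F)) => h [Eh U].
have C : lda_l M · cf F = sf h · lda_l L.
  by rewrite -[LHS]/(cf (colax_comp (lda_counit M) F)) -Eh.
exists (@mkLDMor K T L M (cf F) h C); split.
- apply: counit_comp_inj; first exact: comp1_id_r.
  by rewrite counit_unit_comp.
- move=> φ Eφ; apply: LDMor_eq.
  + by rewrite /= -Eφ /= comp1_id_r.
  + by apply: U; rewrite -Eφ counit_unit_comp.
Qed.

(** The strict 2-cell is the one classified by [lda_counit M ◃ α]; its defining
    equation is the compatibility required of a 2-cell of the comma
    2-category. *)
Lemma lda_unit_universal_2 (M : LDAdj T) (φ ψ : LDMor L M)
    (α : ColaxCell (colax_comp (colax_of_ld φ) lda_unit)
                   (colax_comp (colax_of_ld ψ) lda_unit)) :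
  exists! θ : LDCell φ ψ,
    @rwhisk (LaxTAlgc T) _ _ _ _ _ (fmap2 (lda_lax T) θ) lda_unit = α.
Proof.
pose cell_of Y Z (c : @cells (LaxTAlgc T) Y Z) : cells (lob Y) (lob Z) :=
  match c with Cell β => Cell (ca β) end.
case: (cell_retype (C := LaxTAlgc T) (x := wl (C := LaxTAlgc T) (lda_counit M) (Cell α))
  (counit_unit_comp φ) (counit_unit_comp ψ)) => α' Eα'.
have cα' : Cell (ca α') = wl (lda_l M) (Cell (ca α)).
  exact (f_equal (@cell_of _ _) Eα').
have E1 : cdom (Cell (ca α)) = ld1 φ by exact: comp1_id_r.
have E2 : ccod (Cell (ca α)) = ld1 ψ by exact: comp1_id_r.
case: (cell_retype E1 E2) => a Ea.
case: (classifier_universal_2 H α') => b [Eb U].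
have cb : wr (Cell (sc b)) p = Cell (ca α').
  exact (f_equal (fun c => Cell (ca c)) Eb).
have C : lda_l M ◃ a ≈ sc b ▹ lda_l L.
  by rewrite /heq cell_wl Ea -cα' -cb.
exists (@mkLDCell K T L M φ ψ a b C); split.
- by apply: ColaxCell_eq; apply: Cell_inj; exact (eq_trans (wr_id (Cell a)) Ea).
- move=> θ Eθ.
  have Ea' : Cell (lc1 θ) = Cell a.
    rewrite Ea -Eθ. exact (eq_sym (wr_id _)).
  apply: LDCell_eq; first exact: Cell_inj (eq_sym Ea').
  apply: U; apply: ColaxCell_eq; apply: Cell_inj; rewrite cα' -Ea -Ea'.
  exact (eq_sym (lc_comm θ)).
Qed.

End ClassifierLDA.

(** Everything that has to be chosen for [X], in one record, so that both left
    adjoints use the same choice. *)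
Record ClassifierData (K : TwoCat) (T : TwoMonad K) (X : LaxAlg T) : Type := {
  cl_alg : TAlgs T;
  cl_cone : Cocone (coherence_data X) cl_alg;
  cl_codescent : is_codescent cl_cone;
  cl_forget : is_codescent (map_cocone (forget T) cl_cone);
  cl_q : hom K (sob cl_alg) X;
  cl_adj : Adjunction (cf (classifier_unit cl_cone)) cl_q;
  cl_qg : cl_q · cl_g cl_cone = lx X;
  cl_qγ : wl cl_q (cl_γ cl_cone) = Cell (lxi2 X);
  cl_adj_unit : adj_unit cl_adj ≈ lxi0 X;
  cl_adj_counit :
    wr (Cell (adj_counit cl_adj)) (cl_g cl_cone) = wr (cl_γ cl_cone) (e T (T X))
}.

Lemma classifier_data_ex (K : TwoCat) (T : TwoMonad K)
    (hK : has_codescent K) (hT : preserves_codescent T) (X : LaxAlg T) :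
  exists _ : ClassifierData X, True.
Proof.
case: (strict_codescent (coherence_data X) hK hT) => A [κ [H HU]].
case: (classifier_adjunction HU) => q [adj [E1 [E2 [E3 E4]]]].
by exists (Build_ClassifierData H HU E1 E2 E3 E4).
Qed.

Theorem theorem4p3p6 (K : TwoCat) (T : TwoMonad K)
    (hK : has_codescent K) (hT : preserves_codescent T) :
  exists Q : TwoFunctor (LaxTAlgc T) (TLDAdj T),
    inhabited (TwoAdj Q (lda_lax T)) /\
    fully_faithful Q /\
    exists (Qc : TwoFunctor (LaxTAlgc T) (TAlgs T)) (Qadj : TwoAdj Qc (incl T)),
      forall X : LaxAlg T,
        let p : hom K X (Qc X) := cf (unit2 Qadj X) in
        exists κ : Cocone (coherence_data X) (Qc X),
          let g : hom K (T X) (Qc X) := sf (cc κ) in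
          is_codescent κ /\
          is_codescent (map_cocone (forget T) κ) /\
          p = g · e T X /\
          exists (q : hom K (Qc X) X) (adj : Adjunction p q),
            q · g = lx X /\
            q ◃ sc (cg κ) ≈ lxi2 X /\
            adj_unit adj ≈ lxi0 X /\
            Q X = mkLDAdj adj.
Proof.
pose c X := proj1_sig (constructive_indefinite_description _ (classifier_data_ex hK hT X)).
pose u X := lda_unit (cl_qg (c X)) (cl_qγ (c X)) (cl_adj_unit (c X)) (cl_adj_counit (c X)).
pose u1 X := @lda_unit_universal_1 K T X _ _ (cl_codescent (c X)) _ (cl_adj (c X))
  (cl_qg (c X)) (cl_qγ (c X)) (cl_adj_unit (c X)) (cl_adj_counit (c X)).
pose u2 X := @lda_unit_universal_2 K T X _ _ (cl_codescent (c X)) _ (cl_adj (c X))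
  (cl_qg (c X)) (cl_qγ (c X)) (cl_adj_unit (c X)) (cl_adj_counit (c X)).
exists (ladj (G := lda_lax T) (u := u) u1 u2); split; [|split].
- exact (inhabits (ladj_adj (G := lda_lax T) (u := u) u1 u2)).
- apply: ladj_fully_faithful => X.
  by exists (lda_unit_inv (cl_qg (c X)) (cl_qγ (c X)) (cl_adj_unit (c X)) (cl_adj_counit (c X))); split;
    [exact: lda_unit_invK | exact: lda_unitK].
- pose w1 X := @classifier_universal_1 K T X _ _ (cl_codescent (c X)).
  pose w2 X := @classifier_universal_2 K T X _ _ (cl_codescent (c X)).
  exists (ladj (G := incl T) (u := fun X => classifier_unit (cl_cone (c X))) w1 w2).
  exists (ladj_adj (G := incl T) (u := fun X => classifier_unit (cl_cone (c X))) w1 w2) => X p.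
  exists (cl_cone (c X)); split; first exact: cl_codescent.
  split; first exact: cl_forget.
  split=> //; exists (cl_q (c X)), (cl_adj (c X)).
  split; first exact: cl_qg.
  split; first exact: cl_qγ.
  by split; first exact: cl_adj_unit.
Qed.
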